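(* Let $n\ge2$ and let $\Omega$ be a bounded $s$-John domain in $\mathbb{R}^n$ with $1\le s<\frac{n}{n-1}$. If $\delta\in(0,n]$ and $p>\delta/n$, then there is a constant $c$ depending only on $n,\delta,p,\Omega$ such that \[ \inf_{b\in\mathbb{R}}\int_\Omega|u(x)-b|^p\,d\mathcal{H}^{\delta}_\infty\le c\int_\Omega|\nabla u(x)|^p\,d\mathcal{H}^{\delta}_\infty \] for all $u\in C^1(\Omega)$.
   Context: Let $s\ge1$. A bounded domain (open connected set) $\Omega\subset\mathbb{R}^n$ is an $s$-John domain if there are finite positive constants $c_J,C_J$ and a point $x_0\in\Omega$ such that every $x\in\Omega$ can be joined to $x_0$ by a rectifiable curve $\gamma_x:[0,\ell(\gamma_x)]\to\Omega$ parametrised by arc length with $\gamma_x(0)=x$, $\gamma_x(\ell(\gamma_x))=x_0$, $\ell(\gamma_x)\le C_J$, and $\operatorname{dist}(\gamma_x(t),\partial\Omega)\ge c_J t^s$ for all $t\in[0,\ell(\gamma_x)]$. For $E\subset\mathbb{R}^n$ and $\beta\in(0,n]$, $\mathcal{H}^{\beta}_\infty(E)=\inf\{\sum_i r_i^{\beta}: E\subset\bigcup_i B(x_i,r_i)\}$ over countable or finite coverings by open balls. For $f:\Omega\to[0,\infty]$, $\int_\Omega f\,d\mathcal{H}^{\beta}_\infty:=\int_0^\infty \mathcal{H}^{\beta}_\infty(\{x\in\Omega: f(x)>t\})\,dt$. *)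

(* Defs.v *)
From HB Require Import structures.
From mathcomp Require Import all_boot all_order all_algebra.
From mathcomp Require Import all_classical all_reals all_analysis.
Set Implicit Arguments. Unset Strict Implicit. Unset Printing Implicit Defensive.
Import Order.TTheory GRing.Theory Num.Theory.
Import numFieldNormedType.Exports.
Local Open Scope classical_set_scope.
Local Open Scope ring_scope.

Section Defs.
Variable R : realType.
Variable n : nat.
Notation V := 'rV[R]_n.

Definition enorm (x : V) : R := Num.sqrt (\sum_(i < n) (x ord0 i) ^+ 2).

Definition eball (c : V) (r : R) : set V := [set y | enorm (y - c) < r].

Fixpoint poly_len (gamma : R -> V) (x : R) (ts : seq R) : R :=
  match ts with
  | [::] => 0
  | t :: ts' => enorm (gamma t - gamma x) + poly_len gamma t ts'
  end.

Definition curve_length (gamma : R -> V) (a b : R) : \bar R :=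
  ereal_sup [set (poly_len gamma a ts)%:E |
              ts in [set ts : seq R | path <=%R a ts /\ last a ts = b]].

Definition bdry (O : set V) : set V := closure O `\` interior O.

Definition edist (y : V) (A : set V) : \bar R :=
  ereal_inf [set (enorm (y - z))%:E | z in A].

Definition is_domain (O : set V) : Prop := open O /\ connected O /\ O !=set0.

Definition ebounded (O : set V) : Prop := exists M : R, forall x, O x -> enorm x <= M.

Definition sJohn_domain (s : R) (O : set V) : Prop :=
  is_domain O /\ ebounded O /\
  exists (cJ CJ : R) (x0 : V), 0 < cJ /\ 0 < CJ /\ O x0 /\
    forall x, O x -> exists (gamma : R -> V) (l : R),
      0 <= l /\ l <= CJ /\ gamma 0 = x /\ gamma l = x0 /\
      (* parametrised by arc length (hence rectifiable) *)
      (forall a b, 0 <= a -> a <= b -> b <= l -> curve_length gamma a b = (b - a)%:E) /\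
      (forall t, 0 <= t <= l -> O (gamma t)) /\
      (forall t, 0 <= t <= l -> ((cJ * t `^ s)%:E <= edist (gamma t) (bdry O))%E).

(* beta-dimensional Hausdorff content: countable coverings by open balls
   (finite coverings = countable ones with the remaining radii 0). *)
Definition Hcontent (beta : R) (E : set V) : \bar R :=
  ereal_inf [set S | exists (r : nat -> R) (c : nat -> V),
     (forall i, 0 <= r i) /\ E `<=` \bigcup_i eball (c i) (r i) /\
     S = (\sum_(0 <= i <oo) ((r i) `^ beta)%:E)%E].

Definition choquet (beta : R) (O : set V) (f : V -> R) : \bar R :=
  (\int[@lebesgue_measure R]_(t in `[0%R, +oo[%classic)
     Hcontent beta [set x | O x /\ (t < f x)%R])%E.

Definition ebasis (i : 'I_n) : V := delta_mx ord0 i.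

Definition partial (i : 'I_n) (u : V -> R) (x : V) : R := 'D_(ebasis i) u x.

Definition C1_on (O : set V) (u : V -> R) : Prop :=
  (forall x, O x -> differentiable u x) /\
  (forall i x, O x -> {for x, continuous (partial i u)}).

Definition grad_norm (u : V -> R) (x : V) : R :=
  Num.sqrt (\sum_(i < n) (partial i u x) ^+ 2).

End Defs.

(* Main.v *)
Require Import Defs.
From HB Require Import structures.
From mathcomp Require Import all_boot all_order all_algebra.
From mathcomp Require Import all_classical all_reals all_analysis measurable_realfun.
From mathcomp Require Import ring lra zify.
Import Order.TTheory GRing.Theory Num.Theory.
Import numFieldNormedType.Exports.
Local Open Scope classical_set_scope.
Local Open Scope ring_scope.

(** Cover the superlevel sets of the gradient by balls [B(c_i, r_i)], so that
    the gradient is below [a_i] on some [B(c_i, r_i)] at every point and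
    [sum_i a_i^p r_i^delta] is controlled by its Choquet integral.

    Join [x] to the John centre by a chain of cubes. At distance
    [tau_k = T / 2^k] along the John curve, use cubes of side
    [h_k ~ tau_k^s] and erase the loops of the chain, so that no cube is used
    twice. Averaging the mean value inequality over the segments joining
    corresponding points of consecutive cubes gives
    [|u x - u y| <= S x + S y], where [S x] is the sum over [i] and [k] of
    [a_i h_k (min(r_i, tau_k) / h_k)^n] restricted to
    [|x - c_i| < r_i + 4 tau_k]. Only Riemann sums over finite grids are
    averaged, so no measure on the space is needed. Since
    [h_k (tau_k / h_k)^n] is a multiple of [eta^k] with [eta < 1] exactly when
    [s < n / (n - 1)], raising to the power [p] and integrating loses a
    convergent geometric series: [delta <= n min(1, p)] makes the [k]-th term
    at most a multiple of [eta^(k min(1, p)) a_i^p r_i^delta].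

    The Choquet integral of a sum of indicators of dyadic cubes is at most the
    sum of the integrals: stack the cubes containing a point, coarsest first;
    the level set [{F > t}] is then covered by the cubes whose slab
    contains [t]. *)

(** * Coverings and the Choquet integral *)

Section esum_tools.
Variable R : realType.
Local Open Scope ereal_scope.

Lemma seq_le_esum (I : choiceType) (f : I -> \bar R) (s : seq I) :
  uniq s -> (forall i, 0 <= f i) ->
  \sum_(i <- s) f i <= \esum_(i in [set: I]) f i.
Proof.
move=> us f0; apply: esum_ge; exists [set` s].
  by split => //; exact: finite_seq.
by rewrite -fsbig_seq.
Qed.

Lemma esum_le_seq (I : choiceType) (f : I -> \bar R) (x : \bar R) :
  (forall s : seq I, uniq s -> \sum_(i <- s) f i <= x) ->
  \esum_(i in [set: I]) f i <= x.
Proof.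
move=> h; apply: ge_ereal_sup => _ [X [finX _] <-].
by rewrite fsbig_finite//=; apply: h; exact: finmap.fset_uniq.
Qed.

Lemma esumZl_le (I : choiceType) (c : R) (f : I -> \bar R) :
  (0 <= c)%R -> (forall i, 0 <= f i) ->
  \esum_(i in [set: I]) (c%:E * f i) <= c%:E * \esum_(i in [set: I]) f i.
Proof.
move=> c0 f0; apply: esum_le_seq => s us.
rewrite -ge0_sume_distrr; last by move=> i _; exact: f0.
by apply: lee_wpmul2l; [rewrite lee_fin|exact: seq_le_esum].
Qed.

Lemma esumZl_ge (I : choiceType) (c : R) (f : I -> \bar R) :
  (0 < c)%R -> (forall i, 0 <= f i) ->
  (c%:E * (\esum_(i in [set: I]) f i) <= \esum_(i in [set: I]) (c%:E * f i))%E.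
Proof.
move=> c0 f0; have cf0 i : (0 <= c%:E * f i)%E by rewrite mule_ge0// lee_fin ltW.
have -> : \esum_(i in [set: I]) f i =
    \esum_(i in [set: I]) (c^-1%:E * (c%:E * f i))%E.
  by apply: eq_esum => i _; rewrite muleA -EFinM mulVf ?mul1e// gt_eqF.
have ci : (0 <= c^-1)%R by rewrite invr_ge0 ltW.
have h := esumZl_le I c^-1 (fun i => c%:E * f i)%E ci cf0.
apply: le_trans (lee_wpmul2l _ h) _; first by rewrite lee_fin ltW.
by rewrite muleA -EFinM mulfV ?mul1e// gt_eqF.
Qed.

Lemma esum_prod (I J : choiceType) (f : I * J -> \bar R) :
  (forall k, 0 <= f k) ->
  \esum_(k in [set: I * J]) f k =
  \esum_(i in [set: I]) \esum_(j in [set: J]) f (i, j).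
Proof.
move=> f0; rewrite (@esum_esum R I J setT (fun=> setT) (fun i j => f (i, j)))//.
have -> : [set: I] `*`` (fun=> [set: J]) = [set: I * J].
  by apply/seteqP; split => // -[].
by apply: eq_esum => -[].
Qed.

(** [pickle_inv] is [None] at numbers that code no element, and the default value 0 makes those
    terms vanish. The series form is the one that [Hcontent] and the exchange of sum and integral
    require. *)
Lemma esum_countType (I : countType) (f : I -> \bar R) :
  (forall i, 0 <= f i) ->
  \esum_(i in [set: I]) f i =
  \sum_(0 <= q <oo) oapp f 0 (pickle_inv q : option I).
Proof.
move=> f0; rewrite nneseries_esumT; last by move=> q; case: pickle_inv.
have -> : \esum_(q in [set: nat]) oapp f 0 (pickle_inv q : option I) =
    \esum_(q in (@pickle I) @` [set: I]) oapp f 0 (pickle_inv q).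
  rewrite [RHS]esum_mkcond; apply: eq_esum => q _.
  case: ifPn => // /negP; rewrite inE/= => nq.
  have := @pickle_invK I q.
  by case: pickle_inv => //= x xq; case: nq; exists x.
rewrite esum_image; last by move=> x y _ _; exact: (pcan_inj pickleK).
by apply: eq_esum => i _; rewrite pickleK_inv.
Qed.

End esum_tools.

(** Numbers that code no index get radius 0. Such balls cost nothing because [beta] is positive,
    whereas the power of 0 with exponent 0 would be 1. *)
Lemma Hcontent_le_esum (R : realType) (n : nat) (beta : R) (I : countType)
    (E : set 'rV[R]_n) (r : I -> R) (c : I -> 'rV[R]_n) :
  0 < beta -> (forall i, 0 <= r i) -> E `<=` \bigcup_i eball (c i) (r i) ->
  (Hcontent beta E <= \esum_(i in [set: I]) (r i `^ beta)%:E)%E.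
Proof.
move=> b0 r0 Ec; rewrite esum_countType; last first.
  by move=> i; rewrite lee_fin powR_ge0.
apply: ereal_inf_lbound => /=.
exists (fun q => oapp r 0 (pickle_inv q)), (fun q => oapp c 0 (pickle_inv q)).
split; first by move=> i; case: pickle_inv => /=.
split.
  move=> x /Ec[i _ xi]; exists (pickle i) => //.
  by rewrite pickleK_inv.
apply: eq_eseriesr => i _; case: pickle_inv => //=.
by rewrite powR0// gt_eqF.
Qed.

Lemma Hcontent_ge0 (R : realType) (n : nat) (beta : R) (E : set 'rV[R]_n) :
  (0 <= Hcontent beta E)%E.
Proof.
apply: le_ereal_inf_tmp => _ [r [c [r0 [_ ->]]]].
by apply: nneseries_ge0 => i _ _; rewrite lee_fin powR_ge0.
Qed.

Lemma le_Hcontent (R : realType) (n : nat) (beta : R) (E F : set 'rV[R]_n) :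
  E `<=` F -> (Hcontent beta E <= Hcontent beta F)%E.
Proof.
move=> EF; apply: le_ereal_inf_tmp => _ [r [c [r0 [Fc ->]]]].
apply: ereal_inf_lbound; exists r, c; split => //; split => //.
exact: subset_trans Fc.
Qed.

(* No measurability is needed: both sides are suprema over the simple
   functions below. *)
Lemma ge0_le_integral_nonmeas d (T : measurableType d) (R : realType)
    (mu : {measure set T -> \bar R}) (D : set T) (f1 f2 : T -> \bar R) :
  (forall x, D x -> (0 <= f1 x)%E) -> (forall x, D x -> (f1 x <= f2 x)%E) ->
  (\int[mu]_(x in D) f1 x <= \int[mu]_(x in D) f2 x)%E.
Proof.
move=> f10 f12; rewrite /integral.
have neg0 f : (forall x, D x -> (0 <= f x)%E) -> ((f \_ D)^\- = cst 0)%E.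
  move=> f0; apply/funext => x; rewrite funeneg_restrict /patch.
  by case: ifPn => // xD; rewrite (@ge0_funenegE _ _ D)// => y /f0.
rewrite !neg0//; last by move=> x Dx; exact: le_trans (f10 _ Dx) (f12 _ Dx).
apply: leeB => //; apply: le_ereal_sup => _ [h hf <-]; exists h => //= x.
apply: le_trans (hf x) _; rewrite !funepos_restrict /patch.
case: ifPn => // xD; have Dx : D x by rewrite inE in xD.
by rewrite !(@ge0_funeposE _ _ D)// ?f12// => y Dy; exact: le_trans (f10 _ Dy) (f12 _ Dy).
Qed.

(** * Layering of laminar families *)

Section layering.
Variables (R : realType) (X : Type) (I : countType).
Variables (k : I -> nat) (Q : I -> set X) (lam : I -> R).
Hypothesis lam0 : forall i, 0 <= lam i.
Hypothesis laminar : forall i j x y, (k i <= k j)%N ->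
  Q i x -> Q j x -> Q j y -> Q i y.

(** Coarse levels come first and [pickle] breaks ties. This is a strict well-order: finite lists
    have a last element, and any property that holds somewhere has a first witness. *)
Definition before (i j : I) : Prop :=
  (k i < k j)%N \/ (k i = k j /\ (pickle i < pickle j)%N).

(* The sets containing a given point are stacked as slabs of thickness [lam],
   earlier sets below; this is the height at which the slab of [j] starts. *)
Definition layer_base (j : I) : \bar R :=
  \esum_(i in [set: I])
    (lam i * (`[< before i j /\ exists x, Q i x /\ Q j x >])%:R)%:E.

Lemma layer_base_ge0 j : (0 <= layer_base j)%E.
Proof. by apply: esum_ge0 => i _; rewrite lee_fin mulr_ge0// lam0. Qed.

Lemma before_last (s : seq I) : s != [::] ->
  exists2 j, j \in s & forall i, i \in s -> i != j -> before i j.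
Proof.
elim: s => // a s IH _; have [->|/IH [j js jP]] := eqVneq s [::].
  by exists a; rewrite ?mem_head// => i; rewrite inE => /eqP->; rewrite eqxx.
have [aj|aj] := pselect (before a j).
  exists j; first by rewrite inE js orbT.
  by move=> i; rewrite inE => /orP[/eqP->//|/jP].
exists a; first exact: mem_head.
move=> i; rewrite inE => /orP[/eqP->|]; first by rewrite eqxx.
have [->|ij] := eqVneq i j.
  move=> _ ja; rewrite /before; move: aj; rewrite /before.
  have : pickle j != pickle a by apply: contra ja => /eqP/(pcan_inj pickleK)->.
  lia.
by move=> /jP/(_ ij); move: aj; rewrite /before; lia.
Qed.

(** Let [j] be the last index of [s]. All others come before [j] and share the point [x] with it, so
    their thicknesses are already counted in [layer_base j]. *)
Lemma sum_le_layer_top (x : X) (t : R) (s : seq I) : 0 <= t -> uniq s ->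
  (forall i, i \in s -> Q i x /\ (layer_base i + (lam i)%:E <= t%:E)%E) ->
  \sum_(i <- s) lam i <= t.
Proof.
move=> t0 us H; have [->|s0] := eqVneq s [::]; first by rewrite big_nil.
have [j js jP] := before_last s s0; have [Qj tj] := H j js.
rewrite (perm_big _ (perm_to_rem js))/= big_cons -lee_fin; apply: le_trans tj.
rewrite addrC EFinD; apply: leeD => //.
have urem : uniq (rem j s) by exact: rem_uniq.
apply: le_trans (seq_le_esum _ _ _ (rem j s) urem _); last first.
  by move=> i; rewrite lee_fin mulr_ge0// lam0.
rewrite sumEFin lee_fin big_seq [leRHS]big_seq; apply: ler_sum => i ij.
rewrite asboolT ?mulr1//; move: ij; rewrite mem_rem_uniq// inE => /andP[ij is_].
by split; [exact: jP|exists x; split => //; have [] := H i is_].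
Qed.

(** The index sought is the first one, in the order [before], whose set contains [x] and whose slab
    ends above [t]. The slabs below it all end by [t], so it starts at or below [t]. *)
Lemma layering (x : X) (t : R) : 0 <= t ->
  (t%:E < \esum_(i in [set: I]) (lam i * (`[< Q i x >])%:R)%:E)%E ->
  exists j, [/\ Q j x, (layer_base j <= t%:E)%E &
    (t%:E < layer_base j + (lam j)%:E)%E].
Proof.
move=> t0 tF; pose P j := Q j x /\ (t%:E < layer_base j + (lam j)%:E)%E.
have key (s : seq I) (B : pred I) : uniq s ->
    (forall i, B i -> Q i x /\ ~ P i) ->
    \sum_(i <- s) lam i * (B i)%:R <= t.
  move=> us H; rewrite (eq_bigr (fun i => if B i then lam i else 0)); last first.
    by move=> i _; case: (B i); rewrite ?mulr1 ?mulr0.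
  rewrite -big_mkcond -big_filter; apply: (@sum_le_layer_top x) => //.
    exact: filter_uniq.
  move=> i; rewrite mem_filter => /andP[/H[Qi nP] _]; split => //.
  by rewrite leNgt; apply/negP => ?; exact: nP.
have [j0 Pj0] : exists j, P j.
  apply: contrapT => nP; move: tF; rewrite ltNge => /negP; apply.
  apply: esum_le_seq => s us; rewrite sumEFin lee_fin.
  by apply: key => // i /asboolP Qi; split => // Pi; apply: nP; exists i.
(* The first witness of [P] is found lexicographically: least level, then least code on that
   level. *)
have exk : exists m, `[< exists2 j, P j & k j = m >].
  by exists (k j0); apply/asboolP; exists j0.
case: (ex_minnP exk) => m /asboolP[j1 Pj1 kj1] mmin.
have exq : exists q, `[< exists2 j, P j & k j = m /\ pickle j = q >].
  by exists (pickle j1); apply/asboolP; exists j1.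
case: (ex_minnP exq) => q /asboolP[j Pj [kj qj]] qmin.
exists j; have [Qj tj] := Pj; split => //.
apply: esum_le_seq => s us; rewrite sumEFin lee_fin.
apply: (key s (fun i => `[< before i j /\ exists x0, Q i x0 /\ Q j x0 >])) => //.
(* The earlier set meets [Q j] only at some [y]; laminarity makes it contain [x] as well. *)
move=> i /asboolP[bij [y [Qiy Qjy]]]; split.
  apply: (laminar i j y x) => //; move: bij; rewrite /before; lia.
move=> Pi; have h1 : (m <= k i)%N by apply: mmin; apply/asboolP; exists i.
case: bij => [|[kij pij]]; first by lia.
have : (q <= pickle i)%N.
  by apply: qmin; apply/asboolP; exists i => //; rewrite kij.
lia.
Qed.

End layering.

(** * Grid cells *)

Section grid.
Variables (R : realType) (n : nat).
Notation V := 'rV[R]_n.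

Lemma rV_norm_le (x : V) (e : R) :
  0 <= e -> (forall i, `|x ord0 i| <= e) -> `|x| <= e.
Proof.
move=> e0 H; rewrite [leLHS]mx_normrE; apply/bigmax_leP; split => //= -[i j] _ /=.
by rewrite (ord1 i) H.
Qed.

Lemma rV_coord_le_norm (x : V) i : `|x ord0 i| <= `|x|.
Proof.
rewrite [leRHS]mx_normrE.
exact: (le_bigmax _ (fun ij : 'I_1 * 'I_n => `|x ij.1 ij.2|) (ord0, i)).
Qed.

(** Distances are measured in the supremum norm of ['rV[R]_n], which suits cubes. The Euclidean norm
    of the definitions is compared with it at the cost of a factor [n]. *)
Lemma norm_le_enorm (x : V) : `|x| <= enorm x.
Proof.
apply: rV_norm_le => [|i]; first exact: sqrtr_ge0.
rewrite -sqrtr_sqr ler_wsqrtr// (bigD1 i)//= lerDl sumr_ge0// => j _.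
exact: sqr_ge0.
Qed.

Lemma enorm_le_norm (x : V) : enorm x <= n%:R * `|x|.
Proof.
have h0 : 0 <= n%:R * `|x| by rewrite mulr_ge0.
rewrite -(ger0_norm h0) -sqrtr_sqr ler_wsqrtr//.
have -> : (n%:R * `|x|) ^+ 2 = \sum_(i < n) n%:R * `|x| ^+ 2.
  by rewrite sumr_const card_ord exprMn -mulr_natl; ring.
apply: ler_sum => i _; rewrite -real_normK ?num_real//.
have n1 : 1 <= n%:R :> R by rewrite ler1n; apply: leq_ltn_trans (ltn_ord i).
apply: le_trans (_ : `|x| ^+ 2 <= _); last by rewrite ler_peMl ?sqr_ge0.
by rewrite lerXn2r// ?nnegrE// rV_coord_le_norm.
Qed.

Definition cell (h : R) (x : V) : {ffun 'I_n -> int} :=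
  [ffun i => Num.floor (x ord0 i / h)].

Definition corner (h : R) (z : {ffun 'I_n -> int}) : V :=
  \row_i (h * (z i)%:~R).

Lemma cellP (h : R) (x : V) i : 0 < h ->
  h * (cell h x i)%:~R <= x ord0 i < h * (cell h x i)%:~R + h.
Proof.
move=> h0; rewrite ffunE; have /andP[] := floor_itv (x ord0 i / h).
rewrite ler_pdivlMr// ltr_pdivrMr// intrD => h1 h2.
by apply/andP; split; lra.
Qed.

Lemma norm_sub_corner (h : R) (x : V) : 0 < h ->
  `|x - corner h (cell h x)| <= h.
Proof.
move=> h0; apply: rV_norm_le => [|i]; first exact: ltW.
have /andP[h1 h2] := cellP h x i h0.
by rewrite !mxE ger0_norm; lra.
Qed.

Lemma cell_adj (h : R) (x y : V) i : 0 < h -> `|x - y| <= h ->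
  `|cell h x i - cell h y i| <= 1.
Proof.
move=> h0 xy; have := le_trans (rV_coord_le_norm (x - y) i) xy.
have /andP[h1 h2] := cellP h x i h0; have /andP[h3 h4] := cellP h y i h0.
rewrite !mxE ler_norml => /andP[h5 h6].
have L (a b : int) : h * a%:~R < h * b%:~R + h + h -> a - b <= 1.
  move=> ab; suff : a < b + 2 by lia.
  rewrite -(ltr_int R) -(ltr_pM2l h0) intrD; lra.
by rewrite ler_norml lerNl opprB !L//; lra.
Qed.

(** For an integer [z], whether [z * m <= a] holds depends only on the floor of [a]. This is what
    makes dyadic cells nested. *)
Lemma floor_coarsen (a b : R) (m : nat) : (0 < m)%N ->
  Num.floor a = Num.floor b -> Num.floor (a / m%:R) = Num.floor (b / m%:R).
Proof.
move=> m0; have m0' : 0 < m%:R :> R by rewrite ltr0n.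
suff L (x y : R) : Num.floor x = Num.floor y ->
    Num.floor (x / m%:R) <= Num.floor (y / m%:R).
  by move=> ab; apply/eqP; rewrite eq_le !L.
move=> xy; rewrite floor_ge_int ler_pdivlMr//.
rewrite -[m%:R]/(m%:~R) -intrM -floor_ge_int -xy floor_ge_int intrM.
by rewrite -ler_pdivlMr//; exact: floor_le.
Qed.

Lemma cell_coarsen (D : R) (x y : V) (k l : nat) : (k <= l)%N ->
  cell (D / 2 ^+ l) x = cell (D / 2 ^+ l) y ->
  cell (D / 2 ^+ k) x = cell (D / 2 ^+ k) y.
Proof.
move=> kl E; apply/ffunP => i; rewrite !ffunE.
have [->|D0] := eqVneq D 0; first by rewrite !(mul0r, invr0, mulr0).
have p0 : forall m, 2 ^+ m != 0 :> R by move=> m; rewrite expf_neq0.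
have F (w : V) : w ord0 i / (D / 2 ^+ k) =
    (w ord0 i / (D / 2 ^+ l)) / (2 ^ (l - k))%N%:R.
  have -> : (2 ^+ l : R) = 2 ^+ (l - k) * 2 ^+ k by rewrite -exprD subnK.
  by rewrite natrX; field; rewrite ?p0 ?D0.
rewrite !F; apply: floor_coarsen; first by rewrite expn_gt0.
by have /ffunP/(_ i) := E; rewrite !ffunE.
Qed.

End grid.

(** * Choquet integrals of sums of indicators *)

Section choquet_cells.
Variables (R : realType) (n : nat) (delta D : R).
Hypotheses (delta0 : 0 < delta) (D0 : 0 < D).
Notation V := 'rV[R]_n.

(** The base of a layer may be infinite; its slab is then empty. *)
Lemma layer_interval (S : \bar R) (l : R) : (0 <= S)%E -> 0 <= l ->
  exists2 J : set R, measurable J &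
    J = [set t | (S <= t%:E)%E /\ (t%:E < S + l%:E)%E] /\
    (lebesgue_measure J <= l%:E)%E.
Proof.
case: S => [a a0 l0|_ l0|//].
  exists `[a, a + l[%classic => //; split.
    by apply/seteqP; split => t /=; rewrite in_itv/= -EFinD lee_fin lte_fin => /andP.
  rewrite lebesgue_measure_itv/= lte_fin; case: ifP => _; last by rewrite lee_fin.
  by rewrite -EFinB lee_fin addrC addKr.
exists set0 => //; split; last by rewrite measure0 lee_fin.
by apply/seteqP; split => t //= [].
Qed.

(** At height [t] the superlevel set is covered by the cells whose slab [J i] contains [t].
    Integrating over [t] charges each cell its content times the length of its slab, at most
    [lam i]. *)
Lemma choquet_cells (I : countType) (k : I -> nat) (z : I -> {ffun 'I_n -> int})
    (lam : I -> R) (O : set V) (f : V -> R) :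
  (forall i, 0 <= lam i) ->
  (forall x, O x -> ((f x)%:E <= \esum_(i in [set: I])
     (lam i * (cell R n (D / 2 ^+ k i) x == z i)%:R)%:E)%E) ->
  (choquet delta O f <= ((n.+1%:R : R) `^ delta)%:E *
     \esum_(i in [set: I]) (lam i * (D / 2 ^+ k i) `^ delta)%:E)%E.
Proof.
move=> lam0 Hf.
pose h i := D / 2 ^+ k i.
have h0 i : 0 < h i by rewrite divr_gt0// exprn_gt0.
pose Q i := [set x : V | cell R n (h i) x = z i].
have lamin i j x y : (k i <= k j)%N -> Q i x -> Q j x -> Q j y -> Q i y.
  move=> ij; rewrite /Q/= => <- jx jy; apply: cell_coarsen ij _.
  by rewrite [LHS]jy.
pose S := layer_base R V I k Q lam.
have S0 i : (0 <= S i)%E by exact: layer_base_ge0.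
pose J i := [set t : R | (S i <= t%:E)%E /\ (t%:E < S i + (lam i)%:E)%E].
pose w i := (n.+1%:R * h i) `^ delta.
have w0 i : 0 <= w i by exact: powR_ge0.
have mJ i : measurable (J i).
  by have [B m [e _]] := layer_interval (S i) (lam i) (S0 i) (lam0 i); rewrite /J -e.
have muJ i : (lebesgue_measure (J i) <= (lam i)%:E)%E.
  by have [B m [e ]] := layer_interval (S i) (lam i) (S0 i) (lam0 i); rewrite /J -e.
have cov t : 0 <= t -> (Hcontent delta [set x | O x /\ (t < f x)%R] <=
    \esum_(i in [set: I]) (w i * \1_(J i) t)%:E)%E.
  move=> t0.
  (* The indicator moves inside the power because [delta > 0]: a cell whose slab misses [t] becomes
     a ball of radius 0. *)
  have -> : \esum_(i in [set: I]) (w i * \1_(J i) t)%:E =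
      \esum_(i in [set: I]) ((n.+1%:R * h i * \1_(J i) t) `^ delta)%:E.
    apply: eq_esum => i _; rewrite /w indicE; case: (t \in J i).
      by rewrite !mulr1.
    by rewrite !mulr0 powR0// gt_eqF.
  apply: (@Hcontent_le_esum _ _ _ _ _ _ (fun i => corner R n (h i) (z i))) => //.
    by move=> i; rewrite !mulr_ge0// ltW.
  move=> x [Ox tx].
  have : (t%:E < \esum_(i in [set: I]) (lam i * (`[< Q i x >])%:R)%:E)%E.
    apply: lt_le_trans (_ : ((f x)%:E <= _)%E); first by rewrite lte_fin.
    apply: le_trans (Hf x Ox) _; apply: le_esum => i _; rewrite lee_fin.
    rewrite ler_wpM2l// ler_nat; case: eqP => // e.
    by rewrite asboolT.
  move=> /(layering R V I k Q lam lam0 lamin x t t0)[j [Qj Sj tj]].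
  exists j => //; rewrite /eball/= indicE mem_set//= mulr1.
  (* A point of a cell is within Euclidean distance [n * h j] of the corner; the radius uses [n.+1]
     since balls are open. *)
  apply: le_lt_trans (enorm_le_norm _ _ _) _.
  apply: le_lt_trans (_ : n%:R * h j < _).
    by rewrite ler_wpM2l// -Qj norm_sub_corner.
  by rewrite ltr_pM2r// ltr_nat.
have w'0 q t : (0 <= oapp (fun i => (w i * \1_(J i) t)%:E) 0 (pickle_inv q : option I))%E.
  by case: pickle_inv => //= i; rewrite lee_fin mulr_ge0.
apply: (@le_trans _ _ (\int[@lebesgue_measure R]_(t in `[0%R, +oo[%classic)
    \sum_(0 <= q <oo) oapp (fun i => (w i * \1_(J i) t)%:E) 0 (pickle_inv q : option I))%E).
  apply: ge0_le_integral_nonmeas => t; first by move=> _; exact: Hcontent_ge0.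
  rewrite /= in_itv/= andbT => t0; rewrite -esum_countType; first exact: cov.
  by move=> i; rewrite lee_fin mulr_ge0.
rewrite integral_nneseries//; last first.
  move=> q; case: (pickle_inv q) => [i|] /=; last exact: measurable_cst.
  apply/measurable_EFinP; apply: measurable_funM; first exact: measurable_cst.
  by apply: measurable_indic; exact: mJ.
rewrite esum_countType; last by move=> i; rewrite lee_fin mulr_ge0// powR_ge0.
rewrite -nneseriesZl//; last first.
  by move=> q _; case: pickle_inv => //= i; rewrite lee_fin mulr_ge0// powR_ge0.
apply: lee_nneseries => q.
  by move=> _ _; apply: integral_ge0 => t _; exact: w'0.
case: (pickle_inv q) => [i|] _ /=; last first.
  by rewrite integral0 mule0.
under eq_integral do rewrite EFinM.
rewrite ge0_integralZl//; last 2 first.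
- by apply/measurable_EFinP; apply: measurable_indic; exact: mJ.
- by rewrite lee_fin.
rewrite integral_indic ?mJ//; last exact: mJ.
apply: (@le_trans _ _ ((w i)%:E * (lam i)%:E)%E).
  apply: lee_wpmul2l; first by rewrite lee_fin.
  apply: le_trans (muJ i); apply: le_measure; rewrite ?inE//.
    by apply: measurableI => //; exact: mJ.
  exact: mJ.
by rewrite -!EFinM lee_fin /w powRM// ?(ltW (h0 i))// -/(h i) mulrAC -mulrA.
Qed.

End choquet_cells.

Lemma powR_le_base (R : realType) (r a b : R) :
  0 <= r -> 0 <= a -> a <= b -> a `^ r <= b `^ r.
Proof.
by move=> r0 a0 ab; apply: ge0_ler_powR; rewrite ?nnegrE// (le_trans a0).
Qed.

Lemma dyadic_scale (R : realType) (D r : R) : 0 < r -> r < D ->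
  exists k : nat, D / 2 ^+ k.+1 <= r < D / 2 ^+ k.
Proof.
move=> r0 rD; have ex : exists k : nat, D / 2 ^+ k.+1 <= r.
  have := archi_boundP (ltW (divr_gt0 (lt_trans r0 rD) r0)).
  set N := Num.bound _ => DN; exists N.
  rewrite ler_pdivrMr ?exprn_gt0// -ler_pdivrMl// mulrC.
  apply/ltW/(lt_le_trans DN); rewrite -natrX ler_nat.
  by apply: leq_trans (ltnW (ltn_expl N.+1 (ltnSn 1))).
case: (ex_minnP ex) => k hk kmin; exists k; rewrite hk /= ltNge; apply/negP.
case: k hk kmin => [|k] hk kmin; first by rewrite expr0 divr1 leNgt rD.
by move=> /kmin; rewrite ltnn.
Qed.

Section choquet_balls.
Variables (R : realType) (n : nat) (delta D : R).
Hypotheses (delta0 : 0 < delta) (D0 : 0 < D).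
Notation V := 'rV[R]_n.

Lemma esum_const_le (E : finType) (a : R) : 0 <= a ->
  (\esum_(e in [set: E]) a%:E <= (#|E|%:R * a)%:E)%E.
Proof.
move=> a0; apply: esum_le_seq => s us; rewrite sumEFin lee_fin.
rewrite big_const_seq count_predT iter_addr_0 -[leLHS]mulr_natl ler_wpM2r// ler_nat.
by rewrite -(card_uniqP us) max_card.
Qed.

Lemma choquet_balls (I : countType) (c : I -> V) (rho lam : I -> R)
    (O : set V) (f : V -> R) :
  (forall x, O x -> `|x| < D) ->
  (forall i, 0 <= lam i) -> (forall i, 0 <= rho i) ->
  (forall x, O x -> ((f x)%:E <= \esum_(i in [set: I])
     (lam i * (`|x - c i| < rho i)%R%:R)%:E)%E) ->
  (choquet delta O f <= (n.+1%:R `^ delta * (3 ^+ n * 2 `^ delta))%:E *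
     \esum_(i in [set: I]) (lam i * rho i `^ delta)%:E)%E.
Proof.
move=> OD lam0 rho0 Hf.
pose h k := D / 2 ^+ k.
have h0 k : 0 < h k by rewrite divr_gt0// exprn_gt0.
(* The triple holds level, centre and weight. A ball of radius 0 gets weight 0; one of radius at
   least [D] is replaced by the cube of level 0 about the origin, which contains [O]. *)
have /choice[g gP] : forall i, exists kcl : nat * V * R,
    [/\ 0 <= kcl.2, kcl.2 * h kcl.1.1 `^ delta <= 2 `^ delta * (lam i * rho i `^ delta) &
    forall x, O x -> `|x - c i| < rho i ->
      lam i <= kcl.2 /\ `|x - kcl.1.2| < h kcl.1.1].
  move=> i; have := rho0 i; rewrite le_eqVlt => /orP[/eqP r0|r0].
    exists (0%N, 0, 0); split => //=.
      by rewrite mul0r !mulr_ge0// powR_ge0.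
    by move=> x _; rewrite -r0 ltNge normr_ge0.
  have [rD|Dr] := ltP (rho i) D.
    have [k /andP[k1 k2]] := dyadic_scale R D (rho i) r0 rD.
    exists (k, c i, lam i); split => //=.
      rewrite mulrCA ler_wpM2l// -powRM// powR_le_base ?(ltW delta0) ?(ltW (h0 _))//.
      by move: k1; rewrite /h exprS invfM mulrCA; lra.
    by move=> x _ xc; split => //; exact: lt_trans k2.
  exists (0%N, 0, lam i); split => //=; rewrite /h expr0 divr1.
    rewrite mulrCA ler_wpM2l// -powRM// powR_le_base ?(ltW delta0) ?(ltW D0)//.
    by lra.
  by move=> x Ox _; rewrite subr0 OD.
(* The values 0, 1, 2 code the offsets -1, 0, 1 of a neighbouring cell in each coordinate. *)
pose E := {ffun 'I_n -> 'I_3}.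
pose k (ie : I * E) := (g ie.1).1.1.
pose l (ie : I * E) := (g ie.1).2.
pose z (ie : I * E) := [ffun j => cell R n (h (k ie)) (g ie.1).1.2 j + (ie.2 j)%:Z - 1].
have l0 ie : 0 <= l ie by have [] := gP ie.1.
apply: le_trans (choquet_cells R n delta D delta0 D0 (I * E)%type k z l O f l0 _) _.
  move=> x Ox; apply: le_trans (Hf x Ox) _; rewrite esum_prod; last first.
    by move=> ie; rewrite lee_fin mulr_ge0.
  apply: le_esum => i _; have [xi|xi] := boolP (_ < _); last first.
    by rewrite mulr0; apply: esum_ge0 => e _; rewrite lee_fin mulr_ge0.
  have [_ _ /(_ x Ox xi)[ll xc]] := gP i.
  have ho : 0 < h (g i).1.1 by [].
  pose e : E := [ffun j => inord (absz (cell R n (h (g i).1.1) x j -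
                 cell R n (h (g i).1.1) (g i).1.2 j + 1)%R)].
  apply: le_trans (seq_le_esum _ _ _ [:: e] _ _) => //=; last first.
    by move=> e'; rewrite lee_fin mulr_ge0.
  rewrite big_seq1 lee_fin mulr1 /l /= (_ : _ == _) ?mulr1//.
  apply/eqP/ffunP => j; rewrite [RHS]ffunE /k/=.
  have -> : e j = inord (absz (cell R n (h (g i).1.1) x j -
                 cell R n (h (g i).1.1) (g i).1.2 j + 1)%R) by rewrite ffunE.
  have := cell_adj R n _ x (g i).1.2 j ho (ltW xc).
  set a := cell _ _ _ _ _; set b := cell _ _ _ _ _ => ab.
  by rewrite inordK; lia.
rewrite EFinM -muleA; apply: lee_wpmul2l; first by rewrite lee_fin powR_ge0.
rewrite esum_prod; last by move=> ie; rewrite lee_fin mulr_ge0// powR_ge0.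
apply: (@le_trans _ _ (\esum_(i in [set: I])
    ((3 ^+ n * 2 `^ delta) * (lam i * rho i `^ delta))%:E)%E); last first.
  under eq_esum do rewrite EFinM.
  apply: esumZl_le; first by rewrite mulr_ge0// powR_ge0.
  by move=> i; rewrite lee_fin mulr_ge0// powR_ge0.
apply: le_esum => i _; rewrite /l /k /=.
have K0 : 0 <= (g i).2 * h (g i).1.1 `^ delta.
  by rewrite mulr_ge0// ?powR_ge0//; have [] := gP i.
have cE : #|E| = (3 ^ n)%N by rewrite card_ffun !card_ord.
apply: le_trans (esum_const_le E _ K0) _.
rewrite lee_fin cE natrX -mulrA; apply: ler_wpM2l; first exact: exprn_ge0.
by have [_ + _] := gP i.
Qed.

End choquet_balls.

Lemma dyadic_level (R : realType) (e y : R) : 0 < e -> e < y ->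
  exists m : nat, e * 2 ^+ m < y <= 2 * (e * 2 ^+ m).
Proof.
move=> e0 ey; have ye : 0 < y by exact: lt_trans ey.
have [k] := dyadic_scale R y e e0 ey.
rewrite ler_pdivrMr ?exprn_gt0// ltr_pdivlMr ?exprn_gt0// exprS => /andP[h1 h2].
by exists k; rewrite h2 mulrCA h1.
Qed.

(** * Coverings of dyadic superlevel sets *)

Section choquet_cover.
Variables (R : realType) (n : nat) (delta p e : R).
Hypotheses (p0 : 0 < p) (e0 : 0 < e).
Notation V := 'rV[R]_n.
Variables (O : set V) (g : V -> R).
Hypothesis g0 : forall x, 0 <= g x.

Let t (m : nat) : R := e * 2 ^+ m.
Let t_gt0 m : 0 < t m. Proof. by rewrite mulr_gt0// exprn_gt0. Qed.
Let beta : R := 1 - 2^-1 `^ p.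

Lemma half_powR_lt1 : 0 < beta.
Proof.
have h : 2^-1 `^ p < 1 `^ p.
  by apply: gt0_ltr_powR; rewrite ?nnegrE// invf_lt1// ltr1n.
by move: h; rewrite powR1 /= /beta; lra.
Qed.

Let H (m : nat) := Hcontent delta [set x | O x /\ t m < g x].

(** The intervals from [(t m / 2)]^ p[to]t m [^ p] are disjoint and have length [beta * t m]^
    p[. For]x[in the]m[-th one, the set where]g [^ p] exceeds [x] contains the set where [g] exceeds
    [t m]. *)
Lemma sum_levels_le_choquet :
  (\sum_(0 <= m <oo) ((beta * t m `^ p)%R%:E * H m) <=
   choquet delta O (fun x => (g x `^ p)%R))%E.
Proof.
have H0 m : (0 <= H m)%E by exact: Hcontent_ge0.
pose I (m : nat) : set R := `[(2^-1 * t m) `^ p, t m `^ p[%classic.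
have Im0 m x : I m x -> 0 <= x.
  by rewrite /I/= in_itv/= => /andP[+ _]; apply: le_trans; exact: powR_ge0.
have h m x : (0 <= ((fun=> H m) \_ (I m)) x)%E.
  by rewrite /patch; case: ifP.
have disj m m' x : I m x -> I m' x -> m = m'.
  wlog mm : m m' / (m < m')%N => [W|].
    by have [/W|/W W' ? ?|//] := ltngtP m m'; [exact|apply/esym/W'].
  rewrite /I/= !in_itv/= => /andP[_ x1] /andP[x2 _].
  have : (2^-1 * t m') `^ p < t m `^ p by exact: le_lt_trans x1.
  rewrite ltNge powR_le_base// ?(ltW p0)// ?(ltW (t_gt0 _))//.
  rewrite /t mulrCA ler_pM2l// ler_pdivlMl// -exprS.
  by rewrite ler_weXn2l// ler1n.
apply: (@le_trans _ _ (\int[@lebesgue_measure R]_(x in `[0%R, +oo[%classic)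
    \sum_(0 <= m <oo) ((fun=> H m) \_ (I m)) x)%E); last first.
  apply: ge0_le_integral_nonmeas => x.
    by move=> _; apply: nneseries_ge0 => m _ _; exact: h.
  rewrite /= in_itv/= andbT => x0; rewrite nneseries_esumT; last by move=> m; exact: h.
  apply: esum_le_seq => s us.
  have [[m ms Imx]|no] := pselect (exists2 m, m \in s & I m x); last first.
    rewrite big_seq big1 ?Hcontent_ge0// => m ms; rewrite /patch ifF//.
    by apply/negP; rewrite inE => Imx; apply: no; exists m.
  rewrite (bigD1_seq m)//= [X in (_ + X)%E]big1 ?adde0; last first.
    move=> m' m'm; rewrite /patch ifF//; apply/negP; rewrite inE => Im'x.
    by move: m'm; rewrite (disj _ _ _ Im'x Imx) eqxx.
  rewrite /patch ifT ?inE//; apply: le_Hcontent => y /= [Oy ty]; split => //.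
  move: Imx; rewrite /I/= in_itv/= => /andP[_ x1]; apply: lt_trans x1 _.
  by apply: gt0_ltr_powR; rewrite ?nnegrE// ltW.
rewrite integral_nneseries//; last first.
  by move=> m; apply/measurable_restrict; [exact: measurable_itv..|exact: measurable_cst].
apply: lee_nneseries => m.
  by move=> _ _; rewrite mule_ge0// lee_fin mulr_ge0 ?powR_ge0// ltW// half_powR_lt1.
move=> _; rewrite -integral_mkcondr integral_cst; last by apply: measurableI; exact: measurable_itv.
rewrite (_ : _ `&` _ = I m); last first.
  by apply/seteqP; split => x /=; [case|move=> Imx; split => //; rewrite in_itv/= andbT (Im0 m)].
rewrite muleC; apply: lee_wpmul2l => //.
rewrite [leRHS]lebesgue_measure_itv/= lte_fin.
have -> : (2^-1 * t m) `^ p = 2^-1 `^ p * t m `^ p by rewrite powRM// ltW.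
have tp : 0 < t m `^ p by rewrite powR_gt0.
rewrite ifT; last first.
  by rewrite -subr_gt0; have := mulr_gt0 half_powR_lt1 tp; rewrite /beta mulrBl mul1r.
by rewrite -EFinB lee_fin /beta mulrBl mul1r.
Qed.

Lemma choquet_cover (J : R) :
  (choquet delta O (fun x => (g x `^ p)%R) <= J%:E)%E ->
  exists (c : nat * nat -> V) (r : nat * nat -> R),
  [/\ forall i, 0 <= r i,
      forall x, O x -> e < g x -> exists i, g x <= 2 * t i.1 /\
        eball (c i) (r i) x &
      (\esum_(i in [set: nat * nat]) (t i.1 `^ p * r i `^ delta)%:E <=
        (beta^-1 * J + e)%:E)%E].
Proof.
move=> hJ; have b0 := half_powR_lt1.
have tp m : 0 < t m `^ p by rewrite powR_gt0.
have H0 m : (0 <= H m)%E by exact: Hcontent_ge0.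
have sumH : (\sum_(0 <= m <oo) ((t m `^ p)%:E * H m) <= (beta^-1 * J)%:E)%E.
  rewrite EFinM; apply: le_trans (lee_wpmul2l _ hJ); last by rewrite lee_fin invr_ge0 ltW.
  apply: le_trans (lee_wpmul2l _ sum_levels_le_choquet); last by rewrite lee_fin invr_ge0 ltW.
  rewrite -nneseriesZl; last first.
    by move=> m _; rewrite mule_ge0// lee_fin mulr_ge0// ltW.
  apply: lee_nneseries => m; first by move=> _ _; rewrite mule_ge0// lee_fin ltW.
  by move=> _; rewrite muleA -EFinM mulKf// gt_eqF.
(* A nearly optimal covering exists only if the content is finite, which the bound on the weighted
   sum ensures. *)
have Hfin m : (H m \is a fin_num)%E.
  rewrite ge0_fin_numE// ltey; apply/negP => /eqP Hm.
  suff : ((t m `^ p)%:E * H m <= (beta^-1 * J)%:E)%E by rewrite Hm gt0_muley ?lte_fin.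
  apply: le_trans sumH; rewrite nneseries_esumT; last first.
    by move=> i; rewrite mule_ge0// lee_fin ltW.
  apply: le_trans (seq_le_esum _ _ _ [:: m] _ _) => //; first by rewrite big_seq1.
  by move=> i; rewrite mule_ge0// lee_fin ltW.
have /choice[cr crP] : forall m, exists cr : (nat -> R) * (nat -> V),
    [/\ forall i, 0 <= cr.1 i,
      [set x | O x /\ t m < g x] `<=` \bigcup_i eball (cr.2 i) (cr.1 i) &
      (\sum_(0 <= i <oo) ((cr.1 i) `^ delta)%:E <=
         H m + (e / (2 ^ m.+1)%:R / t m `^ p)%:E)%E].
  move=> m; have em : 0 < e / (2 ^ m.+1)%:R / t m `^ p.
    by rewrite !divr_gt0// ltr0n expn_gt0.
  have [_ [r [c [r0 [cov ->]]]] /ltW lt] := lb_ereal_inf_adherent em (Hfin m).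
  by exists (r, c).
exists (fun i => (cr i.1).2 i.2), (fun i => (cr i.1).1 i.2); split.
- by move=> i; have [] := crP i.1.
- move=> x Ox ex; have [m /andP[m1 m2]] := dyadic_level R e (g x) e0 ex.
  have [_ hcov _] := crP m; have [/=|j _ xj] := hcov x; first by split.
  by exists (m, j).
rewrite esum_prod/=; last by move=> i; rewrite lee_fin mulr_ge0 ?powR_ge0.
apply: (@le_trans _ _ (\esum_(m in [set: nat])
    ((t m `^ p)%:E * H m + (e / (2 ^ m.+1)%:R)%:E))%E).
  apply: le_esum => m _ /=.
  under eq_esum do rewrite EFinM.
  apply: le_trans (esumZl_le _ _ _ _ _ _) _; first by rewrite ltW.
    by move=> j; rewrite lee_fin powR_ge0.
  rewrite -nneseries_esumT; last by move=> j; rewrite lee_fin powR_ge0.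
  have [_ _ hm] := crP m.
  apply: le_trans (lee_wpmul2l _ hm) _; first by rewrite lee_fin ltW.
  rewrite ge0_muleDr//; last by rewrite lee_fin !divr_ge0// ltW.
  by rewrite -EFinM mulrCA mulfV ?mulr1// gt_eqF.
rewrite -nneseries_esumT; last first.
  by move=> m; rewrite adde_ge0 ?mule_ge0// lee_fin ?divr_ge0// ltW.
apply: le_trans (epsilon_trick _ _ _) _.
- by move=> m; rewrite mule_ge0// lee_fin ltW.
- exact: ltW.
by rewrite EFinD; apply: leeD.
Qed.

End choquet_cover.

(** * Averages over finite grids *)

Section mean_value.
Variables (R : realType) (n : nat).
Notation V := 'rV[R]_n.

Lemma grad_norm_ge0 (u : V -> R) x : 0 <= grad_norm u x.
Proof. exact: sqrtr_ge0. Qed.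

Lemma derive_le_grad (u : V -> R) (x v : V) : differentiable u x ->
  `|'D_v u x| <= n%:R * `|v| * grad_norm u x.
Proof.
move=> du; rewrite deriveE// [in leLHS](row_sum_delta v) linear_sum.
apply: le_trans (ler_norm_sum _ _ _) _.
have -> : n%:R * `|v| * grad_norm u x = \sum_(i < n) (`|v| * grad_norm u x).
  by rewrite sumr_const card_ord -[RHS]mulr_natl mulrA.
apply: ler_sum => i _; rewrite linearZ/= normrM; apply: ler_pM => //.
  exact: rV_coord_le_norm.
rewrite -deriveE// -[X in `|X|]/(partial i u x).
rewrite -sqrtr_sqr ler_wsqrtr// (bigD1 i)//= lerDl sumr_ge0// => j _.
exact: sqr_ge0.
Qed.

(** The one-variable mean value theorem is applied to [phi], whose difference quotients are those of
    [u] in the direction [b - a]. *)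
Lemma mvt_segment (u : V -> R) (a b : V) :
  (forall t, 0 <= t <= 1 -> differentiable u (a + t *: (b - a))) ->
  exists2 t, 0 <= t <= 1 &
    `|u b - u a| <= n%:R * `|b - a| * grad_norm u (a + t *: (b - a)).
Proof.
move=> du; set v := b - a.
pose phi (t : R) : R := u (a + t *: v).
have E (t : R) : (fun h : R => h^-1 *: (phi (h *: (1 : R) + t) - phi t)) =
    (fun h : R => h^-1 *: (u (h *: v + (a + t *: v)) - u (a + t *: v))).
  apply/funext => h; rewrite /phi; congr (_ *: (u _ - _)).
  by rewrite [h *: 1]mulr1 scalerDl addrCA.
have dphi (t : R) : 0 <= t <= 1 -> is_derive t 1 phi ('D_v u (a + t *: v)).
  move=> /du/(@diff_derivable _ _ _ _ _ v) dv; apply: DeriveDef.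
    by rewrite /derivable E.
  by rewrite /derive E.
have [||t] := @MVT R phi (fun t => 'D_v u (a + t *: v)) 0 1 ltr01.
- move=> t; rewrite in_itv/= => /andP[t0 t1]; apply: dphi.
  by rewrite !ltW.
- apply: derivable_within_continuous => t; rewrite in_itv/= => t01.
  by have := dphi t t01; case.
rewrite in_itv/= => /andP[t0 t1].
have vb : a + v = b by rewrite /v addrC subrK.
rewrite /phi scale1r scale0r addr0 subr0 mulr1 vb => ->.
have t01 : 0 <= t <= 1 by rewrite !ltW.
by exists t => //; apply: derive_le_grad; exact: du.
Qed.

End mean_value.

Section counting.
Variables (R : realType) (n : nat).

Lemma size_box (lo : 'I_n -> R) (L : R) (s : seq {ffun 'I_n -> int}) :
  0 <= L -> uniq s ->
  (forall z, z \in s -> forall i, lo i <= (z i)%:~R <= lo i + L) ->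
  (size s)%:R <= (L + 1) ^+ n.
Proof.
move=> L0 us H; pose K := Num.trunc L.
have KL : K%:R <= L by rewrite -[leRHS]/L truncn_le.
pose z0 i := Num.ceil (lo i).
have D z i : z \in s -> exists2 m : nat, (m <= K)%N & z i - z0 i = m%:Z.
  move=> /H/(_ i)/andP[h1 h2].
  have h3 : z0 i <= z i by rewrite ceil_le_int.
  exists `|z i - z0 i|%N; last by lia.
  rewrite -ltnS; have := truncnS_gt L; rewrite -/K => LK.
  rewrite -(ltr_nat R); apply: le_lt_trans LK.
  rewrite natr_absz ger0_norm; last by lia.
  rewrite intrD mulrNz; have := ceil_ge (lo i); rewrite -/(z0 i); lra.
pose F (z : {ffun 'I_n -> int}) : {ffun 'I_n -> 'I_K.+1} :=
  [ffun i => inord `|(z i - z0 i)%R|%N].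
have injF : {in s &, injective F}.
  move=> z z' zs z's /ffunP E; apply/ffunP => i.
  have := congr1 val (E i); rewrite !ffunE.
  have [m mK e] := D z i zs; have [m' m'K e'] := D z' i z's.
  rewrite e e' /= !inordK ?ltnS// => mm.
  by apply: (addIr (- z0 i)); rewrite e e' mm.
have : (size (map F s) <= #|{: {ffun 'I_n -> 'I_K.+1}}|)%N.
  rewrite cardE; apply: uniq_leq_size; first by rewrite (map_inj_in_uniq injF).
  by move=> x _; rewrite mem_enum.
rewrite size_map card_ffun !card_ord => hs.
apply: (@le_trans _ _ ((K.+1 ^ n)%N%:R)); first by rewrite ler_nat.
rewrite natrX lerXn2r ?nnegrE ?addr_ge0// -natr1 lerD2r//.
Qed.

End counting.

(** * Averages over one step between cubes *)

Section step.
Variables (R : realType) (n : nat).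
Notation V := 'rV[R]_n.

Definition grid_pt (M : nat) (w : {ffun 'I_n -> 'I_M}) : V :=
  \row_i ((w i)%:R / M%:R).

(** A Riemann sum for the mean over the unit cube. *)
Definition grid_avg (M : nat) (F : {ffun 'I_n -> 'I_M} -> R) : R :=
  (\sum_w F w) / M%:R ^+ n.

Lemma norm_grid_pt M (w : {ffun 'I_n -> 'I_M}) : `|grid_pt M w| <= 1.
Proof.
apply: rV_norm_le => // i; rewrite mxE.
have M0 : (0 < M)%N by apply: leq_ltn_trans (ltn_ord (w i)).
by rewrite ger0_norm// ler_pdivrMr ?ltr0n// mul1r ler_nat ltnW.
Qed.

(* A ball of radius [2r] meets at most [4rM/sig + 1 <= 17rM/h] grid
   coordinates in each direction. *)
Lemma grid_count (M : nat) (q c : V) (sig h r : R) :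
  (0 < M)%N -> 0 < h -> h / 4 <= sig -> 0 < r -> h <= r * M%:R ->
  (#|[pred w | `|q + sig *: grid_pt M w - c| < 2 * r]|)%:R <=
    M%:R ^+ n * (17 * Num.min 1 (r / h)) ^+ n.
Proof.
move=> M0 h0 hsig r0 hM; rewrite -exprMn.
have M0' : 0 < M%:R :> R by rewrite ltr0n.
have [rh|rh] := leP 1 (r / h).
  rewrite mulr1; apply: (@le_trans _ _ (M%:R ^+ n)).
    rewrite -natrX ler_nat; apply: leq_trans (max_card _) _.
    by rewrite card_ffun !card_ord.
  by rewrite lerXn2r ?nnegrE// ?ler_peMr// ?mulr_ge0// ler1n.
have s0 : 0 < sig by apply: lt_le_trans hsig; rewrite divr_gt0.
pose F (w : {ffun 'I_n -> 'I_M}) : {ffun 'I_n -> int} := [ffun i => (w i)%:Z].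
pose s := map F (enum [pred w | `|q + sig *: grid_pt M w - c| < 2 * r]).
have injF : injective F.
  move=> w w' /ffunP E; apply/ffunP => i; apply/val_inj.
  by have := E i; rewrite !ffunE => -[].
have us : uniq s by rewrite map_inj_uniq// enum_uniq.
rewrite cardE -(size_map F) -/s.
pose lo i : R := (c ord0 i - q ord0 i - 2 * r) * M%:R / sig.
have L0 : 0 <= 4 * r * M%:R / sig by rewrite !mulr_ge0// ?invr_ge0 ltW.
apply: le_trans (size_box R n lo _ s L0 us _) _.
  move=> z /mapP[w]; rewrite mem_enum inE => hw -> i; rewrite ffunE.
  have := le_lt_trans (rV_coord_le_norm _ _ _ i) hw.
  rewrite !mxE ltr_norml => /andP[h1 h2].
  rewrite /lo -[((w i)%:Z)%:~R]/((w i)%:R).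
  have -> : (w i)%:R = (sig * ((w i)%:R / M%:R)) * M%:R / sig :> R.
    by field; rewrite !gt_eqF.
  rewrite ler_pM2r ?invr_gt0// ler_pM2r// -mulrDl -mulrDl.
  by rewrite ler_pM2r ?invr_gt0// ler_pM2r//; apply/andP; split; lra.
have r1 : 0 <= r / h by rewrite divr_ge0 ?ltW.
apply: lerXn2r; rewrite ?nnegrE; first exact: addr_ge0.
  by rewrite mulr_ge0 ?(ltW M0')// mulr_ge0.
have a1 : 1 <= r * M%:R / h by rewrite ler_pdivlMr// mul1r.
have a2 : 4 * r * M%:R / sig <= 16 * (r * M%:R / h).
  rewrite ler_pdivrMr// -mulrA.
  have : 4 * (r * M%:R) / h * (h / 4) <= 4 * (r * M%:R) / h * sig.
    by apply: ler_wpM2l => //; rewrite divr_ge0 ?mulr_ge0// ltW.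
  have -> : 4 * (r * M%:R) / h * (h / 4) = r * M%:R by field; rewrite gt_eqF.
  have -> : 4 * (r * M%:R) / h * sig = 4 * (r * M%:R / h * sig) by ring.
  by have := mulrA 4 r M%:R; lra.
have -> : M%:R * (17 * (r / h)) = 17 * (r * M%:R / h) by ring.
lra.
Qed.

Lemma dist_continuous (q : V) : continuous (fun z : V => `|z - q|).
Proof.
move=> y; apply: continuous_comp; last exact: norm_continuous.
apply: continuousB; first exact: (@cvg_id _ (nbhs y)).
exact: cst_continuous.
Qed.

Variables (u : V -> R) (Om : set V) (I : choiceType).
Variables (a r : I -> R) (c : I -> V).
Hypotheses (a0 : forall i, 0 <= a i) (r0 : forall i, 0 <= r i).
Hypothesis uC1 : C1_on Om u.
Hypothesis cov : forall y, Om y ->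
  exists i, `|y - c i| < r i /\ grad_norm u y < a i.

Lemma grad_norm_continuous y : Om y -> {for y, continuous (grad_norm u)}.
Proof.
move=> Oy; apply: continuous_comp; last exact: sqrt_continuous.
apply: cvg_big => [||i _] /=; [exact: add_continuous|exact: (nbhs_filter y)|].
have h := uC1.2 i y Oy.
under eq_fun do rewrite expr2; rewrite expr2; by apply: cvgM; [exact: (nbhs_filter y)|exact: h|exact: h].
Qed.

(** Finitely many balls allow one mesh that is fine compared with all their positive radii.
    Continuity of the gradient makes every point interior to a set of the cover, so compactness
    applies. *)
Lemma finite_subcover (p : V) (rho : R) :
  (forall y, `|y - p| <= rho -> Om y) ->
  exists J : seq I, uniq J /\ forall y, `|y - p| <= rho ->
    exists2 i, i \in J & `|y - c i| < r i /\ grad_norm u y < a i.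
Proof.
move=> KO; pose K := [set y : V | `|y - p| <= rho].
have Kc : compact K.
  apply: bounded_closed_compact.
    exists (`|p| + rho); split; first exact: num_real.
    move=> B hB y Ky; apply: le_trans (ltW hB).
    have := ler_normD (y - p) p; rewrite subrK => h.
    by apply: le_trans h _; rewrite addrC lerD2l.
  have -> : K = (fun y => `|y - p|) @^-1` [set t : R | t <= rho] by [].
  apply: closed_comp; last exact: closed_le.
  by move=> y _; exact: dist_continuous.
pose f i := interior [set y | `|y - c i| < r i /\ grad_norm u y < a i].
move: Kc; rewrite compact_cover => /(_ I setT f)[].
- by move=> i _; exact: open_interior.
- move=> y /KO Oy; have [i [yi gi]] := cov y Oy; exists i => //.
  rewrite /f /interior /=; near=> z; split; near: z.
    exact: (cvgr_lt _ (dist_continuous (c i) y)).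
  exact: (cvgr_lt _ (grad_norm_continuous y Oy)).
- move=> J _ hJ; exists (undup (finmap.enum_fset J)); split; first exact: undup_uniq.
  move=> y Ky; have [i iJ] := hJ y Ky; move=> /interior_subset yi.
  by exists i => //; rewrite mem_undup.
Unshelve. all: by end_near. Qed.

Lemma exists_mesh (J : seq I) (h : R) : 0 < h ->
  exists N : nat, forall i, i \in J -> 0 < r i -> h <= r i * N%:R.
Proof.
move=> h0; elim: J => [|j J [N HN]]; first by exists 0%N.
have [r0j|rj] := ltP 0 (r j); last first.
  exists N => i; rewrite inE => /orP[/eqP-> //|/HN//].
  by rewrite ltNge rj.
exists (N + Num.bound (h / r j))%N => i; rewrite inE => /orP[/eqP-> _|iJ ri].
  rewrite natrD mulrDr; have := archi_boundP (ltW (divr_gt0 h0 r0j)).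
  rewrite ltr_pdivrMr// mulrC => /ltW hb; apply: le_trans hb _.
  by rewrite lerDr mulr_ge0// ltW.
by rewrite natrD mulrDr; apply: le_trans (HN i iJ ri) _; rewrite lerDl mulr_ge0// ltW.
Qed.

(** What the ball [i] contributes to one step: path length at most [2 * h], gradient bound [a i],
    and the fraction of grid points near the ball, as estimated by [grid_count]. *)
Definition step_weight (h : R) (p : V) (i : I) : R :=
  2 * n%:R * h * 17 ^+ n *
  (a i * Num.min 1 (r i / h) ^+ n * (`|p - c i| < r i + 2 * h)%R%:R).

Lemma step_weight_ge0 h p i : 0 < h -> 0 <= step_weight h p i.
Proof.
move=> h0; rewrite /step_weight; apply: mulr_ge0.
  by rewrite !mulr_ge0 ?exprn_ge0// ltW.
by rewrite !mulr_ge0 ?exprn_ge0// le_min ler01 divr_ge0// ltW.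
Qed.

(** Each segment between corresponding points is cut into [m] short pieces and the mean value
    inequality is used on each. If the mean value point lies in a ball, the start of the piece lies
    in the doubled ball, and such starts are counted by [grid_count]. *)
Lemma step_bound (p p' : V) (rho rho' h : R) : 0 < h ->
  h / 4 <= rho -> rho <= h -> h / 4 <= rho' -> rho' <= h -> `|p' - p| <= h ->
  (forall y, `|y - p| <= 2 * h -> Om y) ->
  exists M0, forall M, (M0 <= M)%N ->
  ((grid_avg M (fun w => `|u (p' + rho' *: grid_pt M w) - u (p + rho *: grid_pt M w)|))%:E
    <= \esum_(i in [set: I]) (step_weight h p i)%:E)%E.
Proof.
move=> h0 rl ru rl' ru' pp KO.
have [J [uJ HJ]] := finite_subcover p (2 * h) KO.
have [N HN] := exists_mesh J h h0.
(* From [h <= r i * N] it follows that a piece of length [2 * h / m] is no longer than [r i]. *)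
pose m := (2 * N).+1.
have m0 : 0 < m%:R :> R by rewrite ltr0n.
exists N.+1 => M NM; have M0 : (0 < M)%N by exact: leq_trans NM.
have hm i : i \in J -> 0 < r i -> 2 * h / m%:R <= r i.
  move=> iJ ri; rewrite ler_pdivrMr//.
  have -> : m%:R = 2 * N%:R + 1 :> R by rewrite /m -natr1 natrM.
  have := HN i iJ ri; lra.
have hM i : i \in J -> 0 < r i -> h <= r i * M%:R.
  move=> iJ ri; apply: le_trans (HN i iJ ri) _.
  by rewrite ler_pM2l// ler_nat ltnW.
pose D w := (p' - p) + (rho' - rho) *: grid_pt M w.
pose y (l : nat) w := p + rho *: grid_pt M w + (l%:R / m%:R) *: D w.
(* At a fixed time [s] the points of all segments form a translated grid, scaled by a ratio between
   [h / 4] and [h]. *)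
have yE (s : R) w : p + rho *: grid_pt M w + s *: D w =
    (p + s *: (p' - p)) + (rho + s * (rho' - rho)) *: grid_pt M w.
  by rewrite /D scalerDr scalerA scalerDl addrACA.
have sigP (s : R) : 0 <= s <= 1 -> h / 4 <= rho + s * (rho' - rho) <= h.
  by move=> /andP[s0 s1]; apply/andP; split; nra.
have yball (s : R) w : 0 <= s <= 1 ->
    `|p + rho *: grid_pt M w + s *: D w - p| <= 2 * h.
  move=> s01; have /andP[s1 s2] := sigP s s01; have /andP[s3 s4] := s01.
  rewrite yE -[p + _ + _]addrA [p + _]addrC addrK.
  apply: le_trans (ler_normD _ _) _; rewrite !normrZ mulr2n mulrDl mul1r.
  have s5 : 0 <= rho + s * (rho' - rho) by apply: le_trans s1; rewrite divr_ge0// ltW.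
  rewrite (ger0_norm s3) (ger0_norm s5); apply: lerD.
    by apply: le_trans pp; rewrite ler_piMl.
  apply: le_trans s2; rewrite ler_piMr//; exact: norm_grid_pt.
have DN w : `|D w| <= 2 * h.
  apply: le_trans (ler_normD _ _) _; rewrite normrZ mulr2n mulrDl mul1r; apply: lerD => //.
  apply: (@le_trans _ _ `|rho' - rho|); first by rewrite ler_piMr// norm_grid_pt.
  by rewrite ler_norml; apply/andP; split; lra.
have frac (l : nat) (t : R) : (l < m)%N -> 0 <= t <= 1 -> 0 <= (l%:R + t) / m%:R <= 1.
  move=> lm /andP[t0 t1]; apply/andP; split.
    by rewrite divr_ge0 ?addr_ge0// ltW.
  rewrite ler_pdivrMr// mul1r.
  by apply: le_trans (_ : l%:R + 1 <= _); rewrite ?lerD2l// natr1 ler_nat.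
have stp (l : nat) w : y l.+1 w - y l w = m%:R^-1 *: D w.
  rewrite /y addrAC opprD addrA subrr sub0r addrC -scalerBl -natr1.
  by congr (_ *: _); field; rewrite gt_eqF.
pose near i := (`|p - c i| < r i + 2 * h)%R%:R : R.
have inc (l : nat) w : (l < m)%N -> `|u (y l.+1 w) - u (y l w)| <=
    n%:R * (2 * h / m%:R) *
    \sum_(i <- J) (a i * near i * (`|y l w - c i| < 2 * r i)%R%:R).
  move=> lm.
  have pt (t : R) : y l w + t *: (y l.+1 w - y l w) =
      p + rho *: grid_pt M w + ((l%:R + t) / m%:R) *: D w.
    by rewrite stp /y -addrA scalerA -scalerDl mulrDl.
  have [t t01|t t01] := @mvt_segment R n u (y l w) (y l.+1 w).
    by rewrite pt; apply: uC1.1; apply: KO; apply: yball; exact: frac.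
  set xi := (y l w + _) => ht; apply: le_trans ht _.
  have dN : `|y l.+1 w - y l w| <= 2 * h / m%:R.
    by rewrite stp normrZ ger0_norm ?invr_ge0 ?(ltW m0)// mulrC ler_pM2r ?invr_gt0.
  apply: ler_pM; [by rewrite mulr_ge0|exact: grad_norm_ge0|by rewrite ler_wpM2l|].
  have xib : `|xi - p| <= 2 * h by rewrite /xi pt; apply: yball; exact: frac.
  (* The ball depends on [w] and [l]; bounding by the sum over all of [J] removes the choice. *)
  have [i iJ [xii gi]] := HJ xi xib.
  apply: le_trans (ltW gi) _; rewrite (perm_big _ (perm_to_rem iJ))/= big_cons.
  have ri : 0 < r i by exact: le_lt_trans xii.
  have n1 : `|p - c i| < r i + 2 * h.
    apply: le_lt_trans (ler_distD xi _ _) _.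
    by rewrite (distrC p) addrC; apply: ltr_leD.
  have n2 : `|y l w - c i| < 2 * r i.
    apply: le_lt_trans (ler_distD xi _ _) _.
    rewrite mulr2n mulrDl mul1r; apply: ler_ltD => //.
    apply: le_trans (hm i iJ ri); rewrite /xi opprD addrA subrr sub0r normrN normrZ.
    by move/andP: t01 => [t0 t1]; rewrite ger0_norm//; apply: le_trans dN; rewrite ler_piMl.
  rewrite /near n1 n2 !mulr1 lerDl sumr_ge0// => j _.
  by rewrite !mulr_ge0.
have tot w : `|u (p' + rho' *: grid_pt M w) - u (p + rho *: grid_pt M w)| <=
   \sum_(l < m) n%:R * (2 * h / m%:R) *
    \sum_(i <- J) (a i * near i * (`|y l w - c i| < 2 * r i)%R%:R).
  have -> : p' + rho' *: grid_pt M w = y m w.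
    rewrite /y divff ?gt_eqF// yE !scale1r !mul1r.
    by congr (_ + _ *: _); rewrite addrC subrK.
  have -> : p + rho *: grid_pt M w = y 0%N w by rewrite /y mul0r scale0r addr0.
  rewrite -(telescope_sumr (fun l => u (y l w)))// big_mkord.
  apply: le_trans (ler_norm_sum _ _ _) _.
  by apply: ler_sum => l _; exact: inc.
apply: le_trans (seq_le_esum _ _ _ J uJ _); last first.
  by move=> i; rewrite lee_fin step_weight_ge0.
rewrite sumEFin lee_fin /grid_avg ler_pdivrMr ?exprn_gt0 ?ltr0n//.
apply: le_trans (ler_sum _ (fun w _ => tot w)) _.
rewrite exchange_big/=.
apply: (@le_trans _ _ (\sum_(l < m) n%:R * (2 * h / m%:R) *
   \sum_(i <- J) (a i * near i * (M%:R ^+ n * (17 * Num.min 1 (r i / h)) ^+ n)))).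
  apply: ler_sum => l _; rewrite -mulr_sumr ler_wpM2l//.
    by rewrite mulr_ge0// divr_ge0 ?mulr_ge0// ltW.
  rewrite exchange_big/= big_seq [leRHS]big_seq; apply: ler_sum => i iJ.
  rewrite -mulr_sumr ler_wpM2l ?mulr_ge0//.
  have := r0 i; rewrite le_eqVlt => /orP[/eqP r0i|ri].
    rewrite big1 ?mulr_ge0 ?exprn_ge0 ?mulr_ge0 ?le_min ?ler01 ?divr_ge0 ?(ltW h0)//.
    by move=> w _; rewrite -r0i mulr0 ltNge normr_ge0.
  have lm : 0 <= ((l%:R + 0) / m%:R : R) <= 1 by apply: frac; rewrite ?lexx ?ler01.
  rewrite addr0 in lm; have /andP[s1 _] := sigP (l%:R / m%:R) lm.
  have GC := grid_count M (p + (l%:R / m%:R) *: (p' - p)) (c i) _ h (r i) M0 h0 s1 ri (hM i iJ ri).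
  apply: le_trans _ GC.
  rewrite -natr_sum ler_nat -sum1_card [leqRHS]big_mkcond/=.
  by apply: leq_sum => w _; rewrite inE /= -yE -/(y l w); case: (_ < _).
rewrite sumr_const card_ord -[leLHS]mulr_natl mulrA mulr_sumr mulr_suml.
rewrite le_eqVlt; apply/orP; left; apply/eqP; apply: eq_bigr => i _.
by rewrite /step_weight -/(near i) exprMn; field; rewrite ?gt_eqF.
Qed.

End step.

(** * Chains of cubes along John curves *)

Section john_curve.
Variables (R : realType) (n : nat).
Notation V := 'rV[R]_n.

(** The boundary point is the first one on the segment outside [O]: openness puts it outside, and
    the earlier points of the segment are inside and converge to it. *)
Lemma exit_boundary (O : set V) (x z : V) : open O -> O x -> ~ O z ->
  exists2 w, bdry O w & `|w - x| <= `|z - x|.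
Proof.
move=> oO Ox nOz; pose f (t : R) := x + t *: (z - x).
have fc : continuous f.
  by move=> t; apply: cvgD; [exact: cvg_cst|exact: scalel_continuous].
have nb (B : set V) (t : R) : nbhs (f t) B ->
    exists2 e : R, 0 < e & forall t', `|t - t'| < e -> B (f t').
  move=> Bt; have /nbhs_ballP[e /= e0 he] := fc t _ Bt.
  by exists e => [//|t' tt']; apply: he.
pose A := [set t : R | 0 <= t <= 1 /\ ~ O (f t)].
have A1 : A 1 by split; [rewrite ler01 lexx|rewrite /f scale1r addrC subrK].
have hA : has_inf A by split; [exists 1|exists 0 => t [/andP[]]].
pose t0 := inf A.
have t0l t : A t -> t0 <= t by move=> At; apply: ge_inf => //; case: hA.
have t00 : 0 <= t0 by apply: lb_le_inf; [exists 1|move=> t [/andP[]]].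
have t01 : t0 <= 1 by exact: t0l.
have nOw : ~ O (f t0).
  move=> Ow; have [e e0 he] := nb O t0 (open_nbhs_nbhs (conj oO Ow)).
  have [t At tt] := inf_adherent e0 hA.
  have [_ nOt] := At; apply: nOt; apply: he.
  by rewrite distrC ger0_norm ?subr_ge0 ?t0l// ltrBlDr addrC.
exists (f t0).
  split; last by move=> /interior_subset.
  move=> B /nb[e e0 he].
  have t0p : 0 < t0.
    rewrite lt_neqAle t00 andbT; apply/eqP => t0e; apply: nOw.
    by rewrite -t0e /f scale0r addr0.
  pose t := Num.max 0 (t0 - e / 2).
  have tt0 : t < t0 by rewrite /t gt_max t0p ltrBlDr ltrDl divr_gt0.
  exists (f t); split.
    apply: contrapT => nOt; have : A t.
      split => //; rewrite le_max lexx/=; exact: ltW (lt_le_trans tt0 t01).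
    by move=> /t0l; rewrite leNgt tt0.
  apply: he; rewrite ger0_norm ?subr_ge0 ?ltW//.
  have : t0 - e / 2 <= t by rewrite le_max lexx orbT.
  lra.
by rewrite /f addrC addKr normrZ ger0_norm// ler_piMl.
Qed.

(** The form used below: supremum norm, a common parameter interval, curves that are 1-Lipschitz,
    and balls contained in [O] in place of a distance to the boundary. *)
Lemma john_curves (s : R) (O : set V) : (0 < n)%N -> 1 <= s -> sJohn_domain s O ->
  exists (T c : R) (x0 : V), [/\ 0 < T, 0 < c &
    forall x, O x -> exists gam : R -> V, [/\ gam 0 = x, gam T = x0,
      forall a b, 0 <= a <= T -> 0 <= b <= T -> `|gam a - gam b| <= `|a - b| &
      forall t y, 0 <= t <= T -> `|y - gam t| < c * t `^ s -> O y]].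
Proof.
move=> n0 s1 [[oO _] [_ [cJ [CJ [x0 [cJ0 [CJ0 [Ox0 HJ]]]]]]]].
have n0' : 0 < n%:R :> R by rewrite ltr0n.
have s0 : 0 <= s by exact: le_trans s1.
have /nbhs_ballP[d /= d0 hd] := open_nbhs_nbhs (conj oO Ox0).
have CJs : 0 < CJ `^ s by rewrite powR_gt0.
(* The first entry passes from the Euclidean to the supremum norm; the second keeps the balls inside
   the ball of radius [d] about [x0] while the curve waits there. *)
exists CJ, (Num.min (cJ / n%:R) (d / CJ `^ s)), x0; split => //.
  by rewrite lt_min !divr_gt0.
set c := Num.min _ _; move=> x Ox.
have c0 : 0 < c by rewrite lt_min !divr_gt0.
have [gam [l [l0 [lC [g0 [gl [len [gO gd]]]]]]]] := HJ x Ox.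
have lip a b : 0 <= a -> a <= b -> b <= l -> `|gam b - gam a| <= b - a.
  move=> a0 ab bl; apply: le_trans (norm_le_enorm _ _ _) _.
  rewrite -lee_fin -len//; apply: ereal_sup_ubound; exists [:: b].
    by split => //=; rewrite ab.
  by rewrite /= addr0.
(* Waiting at [x0] gives all curves the same parameter interval. *)
pose g t := if t <= l then gam t else x0.
have glip a b : 0 <= a -> a <= b -> `|g b - g a| <= b - a.
  move=> a0 ab; rewrite /g; have [bl|bl] := leP b l.
    by rewrite (le_trans ab bl) lip.
  have [al|al] := leP a l; last by rewrite subrr normr0 subr_ge0.
  by rewrite -gl; apply: le_trans (lip a l a0 al (lexx l)) _; rewrite lerD2r ltW.
exists g; split.
- by rewrite /g l0.
- rewrite /g; case: leP => // Cl; have -> : CJ = l by apply/eqP; rewrite eq_le Cl lC.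
  exact: gl.
- move=> a b /andP[a0 _] /andP[b0 _]; have [ab|ba] := leP a b.
    by rewrite distrC (distrC a) (ger0_norm (_ : 0 <= b - a)) ?subr_ge0// glip.
  by rewrite (ger0_norm (_ : 0 <= a - b)) ?subr_ge0 ?glip// ltW.
move=> t y /andP[t0 tT] yt.
have ts0 : 0 <= t `^ s by exact: powR_ge0.
move: yt; rewrite /g; have [tl yt|tl yt] := leP t l; last first.
  apply: hd; rewrite -ball_normE /ball_/= distrC.
  apply: lt_le_trans yt _; apply: (@le_trans _ _ (c * CJ `^ s)).
    by rewrite ler_wpM2l ?powR_le_base// ltW.
  by rewrite -ler_pdivlMr// ge_min lexx orbT.
apply: contrapT => nOy; have t0l : 0 <= t <= l by rewrite t0.
have [w bw wy] := exit_boundary O (gam t) y oO (gO t t0l) nOy.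
have : ((cJ * t `^ s)%:E <= (enorm (gam t - w))%:E)%E.
  by apply: le_trans (gd t t0l) _; apply: ereal_inf_lbound; exists w.
rewrite lee_fin leNgt => /negP; apply.
apply: le_lt_trans (enorm_le_norm _ _ _) _.
rewrite distrC -ltr_pdivlMl//; apply: le_lt_trans wy (lt_le_trans yt _).
by rewrite mulrA ler_wpM2r// mulrC ge_min lexx.
Qed.

End john_curve.

(** * One stage of the chain *)

Section stage.
Variables (R : realType) (n : nat).
Notation V := 'rV[R]_n.

Definition adj (z z' : {ffun 'I_n -> int}) : bool :=
  [forall i, `|z i - z' i| <= 1].

Lemma norm_sub_corner_adj (h : R) z z' : 0 < h -> adj z z' ->
  `|corner R n h z' - corner R n h z| <= h.
Proof.
move=> h0 /forallP A; apply: rV_norm_le => [|i]; first exact: ltW.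
rewrite !mxE -mulrBr normrM (ger0_norm (ltW h0)) -intrB ler_piMr ?(ltW h0)//.
by rewrite -intr_norm distrC -[leRHS](mulr1z 1) ler_int.
Qed.

Lemma cell_adj_of_dist (h : R) (x y : V) : 0 < h -> `|x - y| <= h ->
  adj (cell R n h x) (cell R n h y).
Proof. by move=> h0 xy; apply/forallP => i; exact: cell_adj. Qed.

Lemma grid_avg_triangle M (F G H : {ffun 'I_n -> 'I_M} -> R) :
  grid_avg R n M (fun w => `|F w - H w|) <=
  grid_avg R n M (fun w => `|F w - G w|) + grid_avg R n M (fun w => `|G w - H w|).
Proof.
rewrite /grid_avg -mulrDl -big_split/= ler_wpM2r ?invr_ge0 ?exprn_ge0//.
by apply: ler_sum => w _; exact: ler_distD.
Qed.

Variables (u : V -> R) (Om : set V) (I : choiceType).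
Variables (a r : I -> R) (c : I -> V).
Hypotheses (a0 : forall i, 0 <= a i) (r0 : forall i, 0 <= r i).
Hypothesis uC1 : C1_on Om u.
Hypothesis cov : forall y, Om y ->
  exists i, `|y - c i| < r i /\ grad_norm u y < a i.

(** Induction along the path, with one [step_bound] per cube and the triangle inequality. The step
    from the last cube leads to the cube at [p'] of side [rho'], the first of the next scale. *)
Lemma path_chain (h : R) (z0 : {ffun 'I_n -> int}) (s : seq {ffun 'I_n -> int})
    (p' : V) (rho' : R) :
  0 < h -> h / 4 <= rho' -> rho' <= h -> path adj z0 s ->
  `|p' - corner R n h (last z0 s)| <= h ->
  (forall z, z \in z0 :: s -> forall y, `|y - corner R n h z| <= 2 * h -> Om y) ->
  exists M0, forall M, (M0 <= M)%N ->
  ((grid_avg R n M (fun w => `|u (p' + rho' *: grid_pt R n M w) -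
      u (corner R n h z0 + h *: grid_pt R n M w)|))%:E
    <= \sum_(z <- z0 :: s) \esum_(i in [set: I])
         (step_weight R n I a r c h (corner R n h z) i)%:E)%E.
Proof.
move=> h0 hl hu; elim: s z0 => [|z1 s IH] z0 /=.
  move=> _ pp KO.
  have [|M0 HM] := step_bound R n u Om I a r c a0 r0 uC1 cov
    (corner R n h z0) p' h rho' h h0 _ (lexx h) hl hu pp (KO z0 (mem_head _ _)).
    by rewrite ler_pdivrMr// ler_peMr ?(ltW h0)// ler1n.
  by exists M0 => M MM; rewrite big_seq1; exact: HM.
move=> /andP[z01 zs] pp KO.
have [z zs'|M1 HM1] := IH z1 zs pp; first by apply: KO; rewrite inE zs' orbT.
have h4 : h / 4 <= h by rewrite ler_pdivrMr// ler_peMr ?(ltW h0)// ler1n.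
have [M0 HM0] := step_bound R n u Om I a r c a0 r0 uC1 cov
    (corner R n h z0) (corner R n h z1) h h h h0 h4 (lexx h) h4 (lexx h)
    (norm_sub_corner_adj h z0 z1 h0 z01) (KO z0 (mem_head _ _)).
exists (maxn M0 M1) => M; rewrite geq_max => /andP[MM0 MM1].
rewrite big_cons.
apply: le_trans (leeD (HM0 M MM0) (HM1 M MM1)).
rewrite -EFinD lee_fin addrC.
exact: (grid_avg_triangle M (fun w => u (p' + rho' *: grid_pt R n M w))
  (fun w => u (corner R n h z1 + h *: grid_pt R n M w))
  (fun w => u (corner R n h z0 + h *: grid_pt R n M w))).
Qed.

(* [119 = 17 * 7], where [(7 min(r, tau) / h)^n] bounds [min(1, r / h)^n] times
   the number of cubes of the stage that come close to the ball. *)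
Definition stage_weight (h tau : R) (x : V) (i : I) : R :=
  2 * n%:R * h * 119 ^+ n *
  (a i * (Num.min (r i) tau / h) ^+ n * (`|x - c i| < r i + 4 * tau)%R%:R).

Lemma stage_weight_ge0 h tau x i : 0 < h -> 0 <= tau -> 0 <= stage_weight h tau x i.
Proof.
move=> h0 t0; rewrite /stage_weight; apply: mulr_ge0.
  by rewrite !mulr_ge0 ?exprn_ge0// ltW.
by rewrite !mulr_ge0 ?exprn_ge0// divr_ge0 ?(ltW h0)// le_min r0.
Qed.

Lemma count_corners (h d : R) (q : V) (L : seq {ffun 'I_n -> int}) : 0 < h -> 0 <= d ->
  uniq L -> (forall z, z \in L -> `|corner R n h z - q| <= d) ->
  (size L)%:R <= (2 * d / h + 1) ^+ n.
Proof.
move=> h0 d0 uL HL.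
apply: (size_box R n (fun i => (q ord0 i - d) / h)) => //.
  by rewrite divr_ge0 ?mulr_ge0// ltW.
move=> z zL i; have := le_trans (rV_coord_le_norm _ _ _ i) (HL z zL).
rewrite !mxE ler_norml => /andP[h1 h2].
by rewrite -mulrDl ler_pdivrMr// ler_pdivlMr//; apply/andP; split; lra.
Qed.

(** As the cubes are distinct, those close to the ball [i] can be counted in two ways: they lie near
    the ball, and they lie near [x]. *)
Lemma stage_sum (h tau : R) (x : V) (L : seq {ffun 'I_n -> int}) :
  0 < h -> h <= tau -> uniq L ->
  (forall z, z \in L -> `|corner R n h z - x| <= 2 * tau) ->
  (\sum_(z <- L) \esum_(i in [set: I]) (step_weight R n I a r c h (corner R n h z) i)%:E
   <= \esum_(i in [set: I]) (stage_weight h tau x i)%:E)%E.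
Proof.
move=> h0 ht uL HL; have t0 : 0 < tau by exact: lt_le_trans ht.
rewrite -esum_sum; last by move=> i z _ _; rewrite lee_fin step_weight_ge0.
apply: le_esum => i _; rewrite sumEFin lee_fin.
rewrite /step_weight /stage_weight -mulr_sumr -mulr_sumr -!mulrA.
do 3 (apply: ler_wpM2l; rewrite ?(ltW h0)//).
have -> : \sum_(z <- L) (`|corner R n h z - c i| < r i + 2 * h)%R%:R =
    (size [seq z <- L | `|corner R n h z - c i| < r i + 2 * h])%:R :> R.
  by rewrite size_filter -sum1_count natr_sum [RHS]big_mkcond; apply: eq_bigr => z _; case: ifP.
set L' := [seq z <- L | _].
have uL' : uniq L' by exact: filter_uniq.
have S1 : (size L')%:R <= (2 * (r i + 2 * h) / h + 1) ^+ n :> R.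
  apply: (count_corners h _ (c i)) => //; first by rewrite addr_ge0// mulr_ge0// ltW.
  by move=> z; rewrite mem_filter => /andP[/ltW].
have S2 : (size L')%:R <= (2 * (2 * tau) / h + 1) ^+ n :> R.
  apply: (count_corners h _ x) => //; first by rewrite !mulr_ge0// ltW.
  by move=> z; rewrite mem_filter => /andP[_ /HL].
have [L0|[z zL']] : L' = [::] \/ exists z, z \in L'.
  by case: L' {uL' S1 S2} => [|z l]; [left|right; exists z; rewrite mem_head].
  by rewrite L0/= !mulr0 !mulr_ge0 ?exprn_ge0 ?mulr_ge0 ?invr_ge0 ?(ltW h0) ?le_min ?r0 ?(ltW t0).
have -> : `|x - c i| < r i + 4 * tau.
  move: zL'; rewrite mem_filter => /andP[zc zL].
  apply: le_lt_trans (ler_distD (corner R n h z) _ _) _.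
  rewrite distrC; have := HL z zL; lra.
rewrite mulr1 [leLHS]mulrCA [leRHS]mulrCA ler_wpM2l//.
have min0 : 0 <= Num.min 1 (r i / h) by rewrite le_min ler01 divr_ge0// ltW.
have B0 : 0 <= Num.min (r i) tau / h.
  by rewrite divr_ge0 ?(ltW h0)// le_min r0 ltW.
suff [K [K0 SK KK]] : exists K : R, [/\ 0 <= K, (size L')%:R <= K ^+ n &
    Num.min 1 (r i / h) * K <= 7 * (Num.min (r i) tau / h)].
  apply: (@le_trans _ _ (17 ^+ n * (Num.min 1 (r i / h) ^+ n * K ^+ n))).
    by rewrite ler_wpM2l ?exprn_ge0// ler_wpM2l// exprn_ge0.
  rewrite -!exprMn; apply: lerXn2r; rewrite ?nnegrE; [by rewrite !mulr_ge0|by rewrite mulr_ge0|].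
  by move: KK B0; set A := _ * K; set B := _ / h; lra.
(* Small balls use the count near the ball, with [K = 2 * r i / h + 5]; large ones use the count
   near [x], with [K = 4 * tau / h + 1]. *)
have [rt|tr] := leP (r i) tau.
  exists (2 * (r i + 2 * h) / h + 1); split => //.
    by rewrite addr_ge0// divr_ge0 ?mulr_ge0 ?addr_ge0 ?mulr_ge0 ?(ltW h0).
  have -> : 2 * (r i + 2 * h) / h + 1 = 2 * (r i / h) + 5 by field; rewrite gt_eqF.
  set q := r i / h; have q0 : 0 <= q by rewrite divr_ge0 ?(ltW h0).
  by have [q1|q1] := leP 1 q; nra.
exists (2 * (2 * tau) / h + 1); split => //.
  by rewrite addr_ge0// divr_ge0 ?mulr_ge0 ?(ltW h0) ?(ltW t0).
apply: (@le_trans _ _ (1 * (2 * (2 * tau) / h + 1))).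
  rewrite ler_wpM2r ?ge_min ?lexx// addr_ge0// divr_ge0 ?mulr_ge0 ?(ltW h0) ?(ltW t0)//.
rewrite mul1r -!mulrA; have : 1 <= tau / h by rewrite ler_pdivlMr// mul1r.
lra.
Qed.

End stage.

(** * From the John centre to a point *)

Section pointwise.
Variables (R : realType) (n : nat).
Notation V := 'rV[R]_n.

Lemma dist_corners (h h' : R) (y : V) : 0 < h' -> h' <= h ->
  `|corner R n h' (cell R n h' y) - corner R n h (cell R n h y)| <= h.
Proof.
move=> h'0 hh; have h0 : 0 < h by exact: lt_le_trans hh.
apply: rV_norm_le => [|i]; first exact: ltW.
have /andP[h1 h2] := cellP R n h y i h0.
have /andP[h3 h4] := cellP R n h' y i h'0.
by rewrite !mxE ler_norml; apply/andP; split; lra.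
Qed.

Variables (u : V -> R) (Om : set V) (I : choiceType).
Variables (a r : I -> R) (c : I -> V).
Hypotheses (a0 : forall i, 0 <= a i) (r0 : forall i, 0 <= r i).
Hypothesis uC1 : C1_on Om u.
Hypothesis cov : forall y, Om y ->
  exists i, `|y - c i| < r i /\ grad_norm u y < a i.

Definition cell_avg_pt (h : R) (y : V) M (w : {ffun 'I_n -> 'I_M}) : V :=
  corner R n h (cell R n h y) + h *: grid_pt R n M w.

(** Sampling the curve at time steps of at most [h] gives consecutive cells that are adjacent, hence
    a path of cubes from [gam t0] to [gam t1]. *)
Lemma curve_stage (gam : R -> V) (t0 t1 h h' tau : R) (x : V) :
  0 < h -> h <= tau -> h / 4 <= h' -> h' <= h -> t1 <= t0 ->
  (forall t t', t1 <= t <= t0 -> t1 <= t' <= t0 -> `|gam t - gam t'| <= `|t - t'|) ->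
  (forall t y, t1 <= t <= t0 -> `|y - gam t| <= 3 * h -> Om y) ->
  (forall t, t1 <= t <= t0 -> `|gam t - x| <= tau) ->
  exists M0, forall M, (M0 <= M)%N ->
  ((grid_avg R n M (fun w => `|u (cell_avg_pt h' (gam t1) M w) -
      u (cell_avg_pt h (gam t0) M w)|))%:E
    <= \esum_(i in [set: I]) (stage_weight R n I a r c h tau x i)%:E)%E.
Proof.
move=> h0 ht h'l h'h t10 lip KO near.
pose N := (Num.bound ((t0 - t1) / h)).+1.
have N0 : 0 < N%:R :> R by rewrite ltr0n.
have Nh : (t0 - t1) / N%:R <= h.
  rewrite ler_pdivrMr// mulrC -ler_pdivrMr//.
  have := archi_boundP (divr_ge0 (_ : 0 <= t0 - t1) (ltW h0)).
  rewrite subr_ge0 => /(_ t10) /ltW b; apply: le_trans b _.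
  by rewrite ler_nat.
pose t (i : nat) := t0 - (t0 - t1) / N%:R * i%:R.
have tP i : (i <= N)%N -> t1 <= t i <= t0.
  move=> iN; have iN' : i%:R <= N%:R :> R by rewrite ler_nat.
  have q0 : 0 <= (t0 - t1) / N%:R by rewrite divr_ge0 ?subr_ge0 ?(ltW N0).
  have : (t0 - t1) / N%:R * i%:R <= (t0 - t1) / N%:R * N%:R by exact: ler_wpM2l.
  rewrite divfK ?gt_eqF//; have : 0 <= (t0 - t1) / N%:R * i%:R by exact: mulr_ge0.
  by rewrite /t => h1 h2; apply/andP; split; lra.
pose z i := cell R n h (gam (t i)).
pose p := mkseq (fun i => z i.+1) N.
have sp : size p = N by exact: size_mkseq.
have nthz i : (i <= N)%N -> nth (z 0%N) (z 0%N :: p) i = z i.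
  by case: i => // i iN; rewrite /= nth_mkseq.
have zp : path (adj n) (z 0%N) p.
  apply/(pathP (z 0%N)) => i; rewrite size_mkseq => iN.
  rewrite nthz 1?ltnW// nth_mkseq//; apply: cell_adj_of_dist => //.
  apply: le_trans (lip _ _ (tP i (ltnW iN)) (tP i.+1 iN)) _.
  rewrite /t -natr1; have -> : t0 - (t0 - t1) / N%:R * i%:R -
    (t0 - (t0 - t1) / N%:R * (i%:R + 1)) = (t0 - t1) / N%:R by ring.
  by rewrite ger0_norm// divr_ge0 ?subr_ge0 ?(ltW N0).
have lastp : last (z 0%N) p = z N.
  by rewrite (last_nth (z 0%N)) sp nthz.
have inp y : y \in z 0%N :: p -> exists2 i, (i <= N)%N & y = z i.
  move=> /(nthP (z 0%N))[i]; rewrite -[size _]/((size p).+1) sp ltnS => iN <-.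
  by exists i => //; rewrite nthz.
have z0E : z 0%N = cell R n h (gam t0) by rewrite /z /t mulr0 subr0.
have tN : t N = t1 by rewrite /t divfK ?gt_eqF//; ring.
(* Erasing loops makes the cubes of the chain pairwise distinct. *)
case: (shortenP zp) lastp => s zs us sub lasts.
have ins y : y \in z 0%N :: s -> exists2 t', t1 <= t' <= t0 & y = cell R n h (gam t').
  rewrite inE => ys; have [|i iN ->] := inp y; last by exists (t i); [exact: tP|].
  rewrite inE; case/orP: ys => [->//|ys].
  by have -> := sub y ys; rewrite orbT.
have h'0 : 0 < h' by apply: lt_le_trans h'l; rewrite divr_gt0.
have [||M0 HM] := path_chain R n u Om I a r c a0 r0 uC1 cov h (z 0%N) s
    (corner R n h' (cell R n h' (gam t1))) h' h0 h'l h'h zs.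
- by rewrite lasts /z tN; exact: dist_corners.
(* The corner is within [h] of the curve point, so a ball of radius [2 * h] about it stays within
   distance [3 * h] of the curve. *)
- move=> y /ins[t' t'P ->] q qy; apply: (KO t' q t'P).
  apply: le_trans (ler_distD (corner R n h (cell R n h (gam t'))) _ _) _.
  rewrite (distrC _ (gam t')); have := norm_sub_corner R n h (gam t') h0; lra.
exists M0 => M MM; rewrite /cell_avg_pt -z0E.
apply: le_trans (HM M MM) _; apply: stage_sum => //.
move=> y /ins[t' t'P ->].
apply: le_trans (ler_distD (gam t') _ _) _.
rewrite distrC; have := norm_sub_corner R n h (gam t') h0; have := near t' t'P; lra.
Qed.

Variables (T : R) (x0 : V) (h : nat -> R).
Let tau (k : nat) := T / 2 ^+ k.
Hypotheses (T0 : 0 < T) (h_gt0 : forall k, 0 < h k) (h_tau : forall k, h k <= tau k).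
Hypotheses (h_ge : forall k, h k / 4 <= h k.+1) (h_le : forall k, h k.+1 <= h k).
Hypothesis curves : forall x, Om x -> exists gam : R -> V,
  [/\ gam 0 = x, gam T = x0,
    forall t t', 0 <= t <= T -> 0 <= t' <= T -> `|gam t - gam t'| <= `|t - t'| &
    forall k t y, tau k.+1 <= t <= tau k -> `|y - gam t| <= 3 * h k -> Om y].

(** The common reference value at the John centre: it depends on the mesh, but neither on the point
    [x] nor on its curve. *)
Definition base_avg (M : nat) : R := grid_avg R n M (fun w => u (cell_avg_pt (h 0%N) x0 M w)).

(** The first [K] stages together cost at most [X], whatever [K] is. The cubes shrink to [x], and
    continuity of [u] there absorbs the rest into [e]. *)
Lemma chain_bound (x : V) (X e : R) : Om x ->
  (\esum_(ik in [set: I * nat])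
      (stage_weight R n I a r c (h ik.2) (tau ik.2) x ik.1)%:E <= X%:E)%E ->
  0 < e -> exists M0, forall M, (M0 <= M)%N -> `|u x - base_avg M| <= X + e.
Proof.
move=> Ox HX e0; have [gam [g0 gT lip KO]] := curves x Ox.
have tau0 k : 0 < tau k by rewrite divr_gt0// exprn_gt0.
have tauS k : tau k.+1 = tau k / 2 by rewrite /tau exprS invfM mulrA mulrAC.
have tauT k : tau k <= T.
  by rewrite ler_pdivrMr ?exprn_gt0// ler_peMr ?(ltW T0)// exprn_ege1// ler1n.
have sw0 k i : 0 <= stage_weight R n I a r c (h k) (tau k) x i.
  by apply: stage_weight_ge0 => //; exact: ltW.
have chain K : exists M0, forall M, (M0 <= M)%N ->
  ((grid_avg R n M (fun w => `|u (cell_avg_pt (h K) (gam (tau K)) M w) -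
      u (cell_avg_pt (h 0%N) x0 M w)|))%:E <= \sum_(k < K)
      \esum_(i in [set: I]) (stage_weight R n I a r c (h k) (tau k) x i)%:E)%E.
  elim: K => [|K [M0 HM0]].
    exists 0%N => M _; rewrite big_ord0 lee_fin /grid_avg big1 ?mul0r// => w _.
    by rewrite /tau expr0 divr1 gT subrr normr0.
  have rng t : tau K.+1 <= t <= tau K -> 0 <= t <= T.
    by move=> /andP[t1 t2]; rewrite (le_trans (ltW (tau0 _)) t1) (le_trans t2).
  have [||||M1 HM1] := curve_stage gam (tau K) (tau K.+1) (h K) (h K.+1) (tau K) x
    (h_gt0 K) (h_tau K) (h_ge K) (h_le K).
  - by rewrite tauS ler_pdivrMr// ler_peMr ?(ltW (tau0 _))// ler1n.
  - by move=> t t' /rng ? /rng ?; exact: lip.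
  - by move=> t y; exact: KO.
  - move=> t tt; rewrite -g0; have t0T := rng t tt.
    apply: le_trans (lip t 0 t0T _) _; first by rewrite lexx ltW.
    by case/andP: t0T => t0 _; case/andP: tt => _; rewrite subr0 ger0_norm.
  exists (maxn M0 M1) => M; rewrite geq_max => /andP[MM0 MM1].
  rewrite big_ord_recr/=; apply: le_trans (leeD (HM0 M MM0) (HM1 M MM1)).
  rewrite -EFinD lee_fin addrC.
  exact: (grid_avg_triangle R n M
    (fun w => u (cell_avg_pt (h K.+1) (gam (tau K.+1)) M w))
    (fun w => u (cell_avg_pt (h K) (gam (tau K)) M w))
    (fun w => u (cell_avg_pt (h 0%N) x0 M w))).
have chainX K : exists M0, forall M, (M0 <= M)%N ->
  grid_avg R n M (fun w => `|u (cell_avg_pt (h K) (gam (tau K)) M w) -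
      u (cell_avg_pt (h 0%N) x0 M w)|) <= X.
  have [M0 HM] := chain K; exists M0 => M MM; rewrite -lee_fin.
  apply: le_trans (HM M MM) _; apply: le_trans HX.
  rewrite esum_prod/=; last by move=> ik; rewrite lee_fin.
  rewrite -(big_mkord xpredT (fun k => \esum_(i in [set: I])
    (stage_weight R n I a r c (h k) (tau k) x i)%:E)%E).
  rewrite -esum_sum; last by move=> i k _ _; rewrite lee_fin.
  apply: le_esum => i _; apply: seq_le_esum; first exact: iota_uniq.
  by move=> k; rewrite lee_fin.
have uc : {for x, continuous u} by apply: differentiable_continuous; exact: uC1.1.
have /nbhs_ballP[d /= d0 hd] := uc _ (nbhsx_ballx (u x) e e0).
(* A point of the last cube is within [h K + (h K + tau K) <= 3 * tau K] of [x]. *)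
have [K HK] : exists K, 3 * tau K < d.
  have := archi_boundP (ltW (divr_gt0 (mulr_gt0 (ltr0n R 3) T0) d0)).
  set K := Num.bound _ => hK; exists K.
  rewrite /tau mulrA ltr_pdivrMr ?exprn_gt0// [ltRHS]mulrC -ltr_pdivrMr//.
  apply: lt_trans hK _; rewrite -natrX ltr_nat.
  exact: ltn_expl.
have [M0 HM] := chainX K.
exists (maxn 1 M0) => M; rewrite geq_max => /andP[M1 MM].
have Mn0 : 0 < M%:R ^+ n :> R by rewrite exprn_gt0// ltr0n.
have avgc (b : R) : grid_avg R n M (fun=> b) = b.
  rewrite /grid_avg sumr_const card_ffun !card_ord -[X in X / _]mulr_natl natrX.
  by rewrite mulrAC divff ?mul1r// gt_eqF.
have -> : u x - base_avg M =
    grid_avg R n M (fun w => u x - u (cell_avg_pt (h 0%N) x0 M w)).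
  by rewrite -{1}(avgc (u x)) /base_avg /grid_avg -mulrBl -sumrB.
have tri : `|grid_avg R n M (fun w => u x - u (cell_avg_pt (h 0%N) x0 M w))| <=
    grid_avg R n M (fun w => `|u x - u (cell_avg_pt (h 0%N) x0 M w)|).
  rewrite /grid_avg normrM (ger0_norm (_ : 0 <= (M%:R ^+ n)^-1)) ?invr_ge0 ?(ltW Mn0)//.
  by rewrite ler_wpM2r ?invr_ge0 ?ler_norm_sum ?(ltW Mn0).
apply: le_trans tri _.
apply: le_trans (grid_avg_triangle R n M (fun=> u x)
  (fun w => u (cell_avg_pt (h K) (gam (tau K)) M w))
  (fun w => u (cell_avg_pt (h 0%N) x0 M w))) _.
rewrite addrC; apply: lerD; first exact: HM.
rewrite -[leRHS]avgc /grid_avg ler_wpM2r ?invr_ge0 ?(ltW Mn0)//.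
apply: ler_sum => w _; apply/ltW; apply: hd.
rewrite -ball_normE /ball_/= distrC.
apply: le_lt_trans HK; rewrite /cell_avg_pt addrAC.
apply: le_trans (ler_normD _ _) _.
have hg : `|h K *: grid_pt R n M w| <= tau K.
  rewrite normrZ ger0_norm ?(ltW (h_gt0 _))//.
  by apply: le_trans (h_tau K); rewrite ler_piMr ?(ltW (h_gt0 _))// norm_grid_pt.
have hc : `|corner R n (h K) (cell R n (h K) (gam (tau K))) - x| <= h K + tau K.
  apply: le_trans (ler_distD (gam (tau K)) _ _) _.
  rewrite distrC; apply: lerD; first exact: norm_sub_corner.
  rewrite -g0; apply: le_trans (lip _ _ _ _) _; rewrite ?lexx ?(ltW (tau0 _)) ?tauT ?(ltW T0)//.
  by rewrite subr0 ger0_norm// ltW.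
have := h_tau K; lra.
Qed.

End pointwise.

(** * Oscillation and the Poincare inequality *)

Lemma powRD_gt0 (R : realType) (x a b : R) : 0 < x ->
  x `^ (a + b) = x `^ a * x `^ b.
Proof. by move=> x0; rewrite powRD// (gt_eqF x0) implybT. Qed.

Section sums.
Variable R : realType.

Lemma esum_geometric (q : R) : 0 <= q -> q < 1 ->
  (\esum_(k in [set: nat]) (q ^+ k)%:E <= ((1 - q)^-1)%:E)%E.
Proof.
move=> q0 q1; apply: esum_le_seq => s us; rewrite sumEFin lee_fin.
pose N := (\max_(k <- s) k).+1.
have sN k : k \in s -> (k < N)%N.
  by move=> ks; rewrite ltnS; apply: (leq_bigmax_seq _ ks).
have -> : \sum_(k <- s) q ^+ k = \sum_(k <- iota 0 N | k \in s) q ^+ k.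
  rewrite -[RHS]big_filter; apply: perm_big; apply: uniq_perm => //.
    by rewrite filter_uniq// iota_uniq.
  move=> k; rewrite mem_filter mem_iota /= add0n.
  by have [/sN->|] := boolP (k \in s).
apply: (@le_trans _ _ (\sum_(k < N) q ^+ k)).
  rewrite -(big_mkord xpredT (fun k => q ^+ k)) /index_iota subn0 [leLHS]big_mkcond.
  by apply: ler_sum => k _; case: ifP => // _; rewrite exprn_ge0.
have q1' : 0 < 1 - q by rewrite subr_gt0.
rewrite -[leRHS]mul1r ler_pdivlMr// mulrC -opprB mulNr -subrX1 opprB.
by rewrite lerBlDr lerDl exprn_ge0.
Qed.

Lemma esum_root (I : choiceType) (b : I -> R) (p X : R) : 0 < p -> p <= 1 ->
  (forall i, 0 <= b i) -> 0 < X ->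
  (\esum_(i in [set: I]) (b i `^ p)%:E <= X%:E)%E ->
  (\esum_(i in [set: I]) (b i)%:E <= (X `^ p^-1)%:E)%E.
Proof.
move=> p0 p1 b0 X0 HX; apply: esum_le_seq => s us; rewrite sumEFin lee_fin.
have bX i : b i <= X `^ p^-1.
  have : b i `^ p <= X.
    rewrite -lee_fin; apply: le_trans HX.
    apply: le_trans (seq_le_esum _ _ _ [:: i] _ _) => //; first by rewrite big_seq1.
    by move=> j; rewrite lee_fin powR_ge0.
  move=> /(powR_le_base _ p^-1 _ _ _ (powR_ge0 _ _)).
  rewrite -powRrM mulfV ?gt_eqF// powRr1//; apply.
  by rewrite invr_ge0 ltW.
have sX : \sum_(i <- s) b i `^ p <= X.
  rewrite -lee_fin -sumEFin; apply: le_trans HX; apply: seq_le_esum => // i.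
  by rewrite lee_fin powR_ge0.
have [Y [Y0 YX XY]] : exists Y, [/\ 0 < Y, Y `^ p = X & X `^ p^-1 = Y].
  exists (X `^ p^-1); split => //; first exact: powR_gt0.
  by rewrite -powRrM mulVf ?gt_eqF// powRr1// ltW.
rewrite XY in bX *.
have bE i : b i <= Y `^ (1 - p) * b i `^ p.
  have := b0 i; rewrite le_eqVlt => /orP[/eqP <-|bi].
    by rewrite mulr_ge0 ?powR_ge0.
  have {1}-> : b i = b i `^ (1 - p) * b i `^ p.
    by rewrite -powRD_gt0// subrK powRr1// ltW.
  apply: ler_wpM2r; first exact: powR_ge0.
  by apply: powR_le_base; rewrite ?subr_ge0// ltW.
apply: le_trans (ler_sum _ (fun i _ => bE i)) _.
rewrite -mulr_sumr; apply: le_trans (ler_wpM2l (powR_ge0 _ _) sX) _.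
by rewrite -YX -powRD_gt0// subrK powRr1// ltW.
Qed.

Lemma esum_option (J : choiceType) (f : option J -> \bar R) :
  (forall i, 0 <= f i)%E ->
  \esum_(i in [set: option J]) f i =
  (f None + \esum_(j in [set: J]) f (Some j))%E.
Proof.
move=> f0; rewrite (esumID [set None])//; congr (_ + _)%E.
  by rewrite setTI esum_set1.
rewrite setTI -(esum_image [set: J] (@Some J) f); last by move=> x y _ _ [].
congr esum; apply/seteqP; split => [[j|]|_ [j _ <-]] //=.
by exists j.
Qed.

End sums.

(** * Scales along the John curve *)

Section scales.
Variables (R : realType) (n : nat) (s T c : R).
Hypotheses (n2 : (2 <= n)%N) (s1 : 1 <= s) (sn : s < n%:R / (n%:R - 1)).
Hypotheses (T0 : 0 < T) (c0 : 0 < c).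

Let S : R := 2 `^ s.
Let n1 : 0 < n%:R - 1 :> R. Proof. by rewrite subr_gt0 ltr1n. Qed.

(** The threshold [n / (n - 1)] is at most 2. Hence successive radii shrink by a factor of at most
    4, the ratio allowed in [step_bound]. *)
Lemma s_le2 : s <= 2.
Proof.
apply/ltW/(lt_le_trans sn); rewrite ler_pdivrMr//.
have : 2%:R <= n%:R :> R by rewrite ler_nat.
lra.
Qed.

Lemma S_ge2 : 2 <= S.
Proof. by rewrite -[leLHS]powRr1// ler_powR// ler1n. Qed.

Lemma S_le4 : S <= 4.
Proof.
have -> : 4 = 2 `^ 2%:R :> R by rewrite powR_mulrn// -natrX.
by apply: ler_powR; [rewrite ler1n|exact: s_le2].
Qed.

Let S0 : 0 < S. Proof. exact: lt_le_trans S_ge2. Qed.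

Lemma powR_tau k : (T / 2 ^+ k) `^ s * S ^+ k = T `^ s.
Proof.
have -> : S ^+ k = (2 ^+ k) `^ s.
  have e1 : S ^+ k = S `^ k%:R by rewrite powR_mulrn// ltW.
  have e2 : 2 ^+ k = 2 `^ k%:R :> R by rewrite powR_mulrn.
  by rewrite e1 e2; apply: etrans (powRrM _ _ _); rewrite mulrC powRrM.
by rewrite -powRM ?divr_ge0 ?exprn_ge0 ?(ltW T0)// divfK// expf_neq0.
Qed.

(** A multiple of the [s]-th power of [T / 2 ^+ k]. The bound by [T] keeps it below that time; the
    16 leaves room for the factor 3 in the tube about the curve and for [S <= 4], lost in passing to
    scale [k.+1]. *)
Definition john_radius (k : nat) : R := Num.min (c * T `^ s / 16) T / S ^+ k.

Let h0 : 0 < Num.min (c * T `^ s / 16) T.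
Proof. by rewrite lt_min T0 andbT divr_gt0 ?mulr_gt0// powR_gt0. Qed.

Lemma john_radius_gt0 k : 0 < john_radius k.
Proof. by rewrite divr_gt0// exprn_gt0. Qed.

Lemma john_radius_le_tau k : john_radius k <= T / 2 ^+ k.
Proof.
rewrite /john_radius; apply: ler_pM; rewrite ?(ltW h0) ?invr_ge0 ?exprn_ge0 ?(ltW S0)//.
  by rewrite ge_min lexx orbT.
rewrite lef_pV2 ?posrE ?exprn_gt0//.
by rewrite lerXn2r ?nnegrE ?(ltW S0) ?S_ge2.
Qed.

Lemma john_radius_ge k : john_radius k / 4 <= john_radius k.+1.
Proof.
rewrite /john_radius exprS invfM mulrA mulrAC ler_wpM2r ?invr_ge0 ?exprn_ge0 ?(ltW S0)//.
by rewrite ler_wpM2l ?(ltW h0)// lef_pV2 ?posrE ?S_le4.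
Qed.

Lemma john_radius_le k : john_radius k.+1 <= john_radius k.
Proof.
rewrite /john_radius exprS invfM mulrCA ler_piMl ?(ltW (john_radius_gt0 k))//.
by rewrite invf_le1//; apply: le_trans S_ge2; rewrite ler1n.
Qed.

Lemma john_radius_lt_john k t : T / 2 ^+ k.+1 <= t -> 3 * john_radius k < c * t `^ s.
Proof.
move=> ht; have tk : 0 < T / 2 ^+ k.+1 by rewrite divr_gt0// exprn_gt0.
have Sk : 0 < S ^+ k.+1 by rewrite exprn_gt0.
apply: (@lt_le_trans _ _ (c * (T / 2 ^+ k.+1) `^ s)); last first.
  by rewrite ler_wpM2l ?(ltW c0)// powR_le_base ?(ltW tk)// (le_trans _ s1).
rewrite -(ltr_pM2r Sk) -[ltRHS]mulrA powR_tau /john_radius exprS.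
have -> : 3 * (Num.min (c * T `^ s / 16) T / S ^+ k) * (S * S ^+ k) =
   3 * Num.min (c * T `^ s / 16) T * S.
  by field; rewrite expf_neq0// gt_eqF.
have m1 : Num.min (c * T `^ s / 16) T <= c * T `^ s / 16 by rewrite ge_min lexx.
have P : 0 < c * T `^ s by rewrite mulr_gt0// powR_gt0.
apply: (@le_lt_trans _ _ (3 * (c * T `^ s / 16) * 4)).
  by apply: ler_pM; rewrite ?mulr_ge0 ?(ltW h0) ?(ltW S0) ?S_le4// ler_wpM2l.
lra.
Qed.

(** This is 2 to the power [s * (n - 1) - n], a negative exponent by the bound on [s]. *)
Definition decay : R := S ^+ n.-1 / 2 ^+ n.

Lemma decay_gt0 : 0 < decay.
Proof. by rewrite divr_gt0 ?exprn_gt0. Qed.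

Lemma decay_lt1 : decay < 1.
Proof.
rewrite /decay ltr_pdivrMr ?exprn_gt0// mul1r.
rewrite -[S ^+ _]powR_mulrn ?(ltW S0)// -[ltRHS]powR_mulrn// -powRrM.
have np : n.-1%:R = n%:R - 1 :> R by rewrite -subn1 natrB// ltnW.
pose d := n%:R - s * (n%:R - 1).
have d0 : 0 < d by rewrite subr_gt0 -ltr_pdivlMr.
have -> : n%:R = s * n.-1%:R + d by rewrite /d np addrC subrK.
rewrite powRD_gt0// ltr_pMr ?powR_gt0//.
have : 1 `^ d < 2 `^ d by apply: gt0_ltr_powR; rewrite ?nnegrE// ltr1n.
by rewrite powR1.
Qed.

Definition weight_const : R := john_radius 0 * (T / john_radius 0) ^+ n.

Lemma weight_const_gt0 : 0 < weight_const.
Proof.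
by rewrite mulr_gt0 ?john_radius_gt0// exprn_gt0// divr_gt0// john_radius_gt0.
Qed.

Lemma john_radius_weight k r : 0 <= r ->
  john_radius k * (Num.min r (T / 2 ^+ k) / john_radius k) ^+ n =
  weight_const * decay ^+ k * Num.min 1 (r / (T / 2 ^+ k)) ^+ n.
Proof.
move=> r0; have tk : 0 < T / 2 ^+ k by rewrite divr_gt0// exprn_gt0.
have r00 := john_radius_gt0 0; set h := john_radius 0 in r00 *.
have rk : john_radius k = h / S ^+ k by rewrite /h /john_radius expr0 divr1.
have tm : Num.min r (T / 2 ^+ k) = (T / 2 ^+ k) * Num.min 1 (r / (T / 2 ^+ k)).
  rewrite minr_pMr ?(ltW tk)// mulr1 mulrCA divff ?gt_eqF//.
  by rewrite mulr1 minC.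
rewrite /weight_const -/h /decay rk tm; set m := Num.min 1 _.
have e1 : T / 2 ^+ k * m / (h / S ^+ k) = (T / h) * (S ^+ k / 2 ^+ k) * m.
  by field; rewrite !expf_neq0 ?gt_eqF.
have e2 : S ^+ (k * n) = S ^+ k * S ^+ (k * n.-1).
  by rewrite -exprD -mulnS prednK// ltnW.
rewrite e1 !exprMn !exprVn -!exprM e2 [(n.-1 * k)%N]mulnC [(n * k)%N]mulnC.
by field; rewrite !expf_neq0 ?gt_eqF.
Qed.

End scales.

(** * Powers of the potential *)

Section oscillation.
Variables (R : realType) (n : nat) (p : R).
Hypothesis p0 : 0 < p.
Notation V := 'rV[R]_n.

Definition ball_kernel (C eta T : R) (k : nat) (r : R) : R :=
  C * eta ^+ k * Num.min 1 (r / (T / 2 ^+ k)) ^+ n.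

Lemma ball_kernel_ge0 C eta T k r : 0 < C -> 0 < eta -> 0 < T -> 0 <= r ->
  0 <= ball_kernel C eta T k r.
Proof.
move=> C0 eta0 T0 r0; have tk : 0 < T / 2 ^+ k by rewrite divr_gt0// exprn_gt0.
rewrite /ball_kernel; apply: mulr_ge0.
  by apply: mulr_ge0; [exact: ltW|apply: exprn_ge0; exact: ltW].
by rewrite exprn_ge0// le_min ler01 divr_ge0// ltW.
Qed.

(** Put [t = T / 2 ^+ k] and [m = min(1, r / t)]. As [m <= 1] and [delta <= n * q], the power
    [n * q] of [m] is at most its power [delta], and [m * (r + 4 * t) <= 5 * r] trades the enlarged
    radius for [r]. *)
Lemma ball_kernel_power_bound (C eta T q delta : R) (k : nat) (r : R) :
  0 < C -> 0 < eta -> 0 < T -> 0 <= r -> 0 < q -> 0 < delta -> delta <= n%:R * q ->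
  ball_kernel C eta T k r `^ q * (r + 4 * (T / 2 ^+ k)) `^ delta <=
  C `^ q * 5 `^ delta * (eta `^ q) ^+ k * r `^ delta.
Proof.
move=> C0 eta0 T0 r0 q0 d0 dn.
have tk : 0 < T / 2 ^+ k by rewrite divr_gt0// exprn_gt0.
rewrite /ball_kernel; set t := T / 2 ^+ k in tk *; clearbody t.
have m0 : 0 <= Num.min 1 (r / t) by rewrite le_min ler01 divr_ge0// ltW.
have C0' := ltW C0; have eta0' := ltW eta0; have tk' := ltW tk.
rewrite powRM ?mulr_ge0 ?exprn_ge0// powRM ?exprn_ge0//.
have -> : (eta ^+ k) `^ q = (eta `^ q) ^+ k.
  elim: k => [|k IH]; first by rewrite !expr0 powR1.
  by rewrite !exprS powRM ?exprn_ge0// IH.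
have e1 : (Num.min 1 (r / t) ^+ n) `^ q <= Num.min 1 (r / t) `^ delta.
  rewrite -[Num.min 1 (r / t) ^+ n]powR_mulrn// -powRrM.
  move: m0; rewrite le_eqVlt => /orP[/eqP<-|m0].
    by rewrite !powR0 ?gt_eqF// (lt_le_trans d0).
  rewrite -[n%:R * q](subrK delta) powRD_gt0// ler_piMl ?powR_ge0//.
  apply: le_trans (_ : 1 `^ (n%:R * q - delta) <= _); last by rewrite powR1.
  by apply: powR_le_base; rewrite ?subr_ge0// ?ge_min ?lexx// ltW.
have e2 : Num.min 1 (r / t) `^ delta * (r + 4 * t) `^ delta <= 5 `^ delta * r `^ delta.
  rewrite -!powRM ?addr_ge0 ?mulr_ge0//.
  apply: powR_le_base; rewrite ?mulr_ge0 ?addr_ge0 ?mulr_ge0 ?(ltW d0)//.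
  have [rt|rt] := leP 1 (r / t).
    by rewrite mul1r; move: rt; rewrite ler_pdivlMr// mul1r; lra.
  have rt' : r <= t by move: rt; rewrite ltr_pdivrMr// mul1r => /ltW.
  have -> : r / t * (r + 4 * t) = r / t * r + 4 * r by field; rewrite gt_eqF.
  have : r / t * r <= 1 * r by rewrite ler_wpM2r// ltW.
  lra.
have P0 : 0 <= C `^ q * (eta `^ q) ^+ k by rewrite mulr_ge0 ?exprn_ge0 ?powR_ge0.
apply: (@le_trans _ _ (C `^ q * (eta `^ q) ^+ k *
    (Num.min 1 (r / t) `^ delta * (r + 4 * t) `^ delta))).
  rewrite -mulrA; apply: ler_wpM2l => //.
  by apply: ler_wpM2r e1; exact: powR_ge0.
apply: le_trans (ler_wpM2l P0 e2) _.
by rewrite le_eqVlt; apply/orP; left; apply/eqP; ring.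
Qed.

Variables (u : V -> R) (Om : set V) (I : choiceType).
Variables (a r : I -> R) (c : I -> V) (i0 : I).
Hypotheses (a0 : forall i, 0 <= a i) (r0 : forall i, 0 <= r i).
Variables (T : R) (C eta : R).
Hypotheses (T0 : 0 < T) (C0 : 0 < C) (eta0 : 0 < eta) (eta1 : eta < 1).
Hypothesis cov : forall y, Om y ->
  exists i, `|y - c i| < r i /\ grad_norm u y < a i.
Hypothesis big_ball : forall y, Om y -> `|y - c i0| < r i0.

Definition in_ball (x : V) (ik : I * nat) : R :=
  (`|x - c ik.1| < r ik.1 + 4 * (T / 2 ^+ ik.2))%R%:R.

Definition potential (b : I -> R) (x : V) : \bar R :=
  \esum_(ik in [set: I * nat])
    (b ik.1 * ball_kernel C eta T ik.2 (r ik.1) * in_ball x ik)%:E.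

(* Quantified over the heights [b], since for [p > 1] it is applied to [tilt]. *)
Hypothesis osc : forall (b : I -> R), (forall i, 0 <= b i) ->
  (forall y, Om y -> exists i, `|y - c i| < r i /\ grad_norm u y < b i) ->
  forall x y X Y, Om x -> Om y -> (potential b x <= X%:E)%E ->
    (potential b y <= Y%:E)%E -> `|u x - u y| <= X + Y.

Let q := Num.min 1 p.

(** The kernel is raised only to [q = min(1, p)]: for [p <= 1] the power passes under the sum, and
    for [p > 1] only the heights are linearised. *)
Definition potential_pow (x : V) : \bar R :=
  \esum_(ik in [set: I * nat])
    (a ik.1 `^ p * ball_kernel C eta T ik.2 (r ik.1) `^ q * in_ball x ik)%:E.

Let in_ball01 x ik : in_ball x ik = 0 \/ in_ball x ik = 1.
Proof. by rewrite /in_ball; case: (_ < _); [right|left]. Qed.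

Let in_ball_ge0 x ik : 0 <= in_ball x ik.
Proof. by have [->|->] := in_ball01 x ik. Qed.

Let k0 k i : 0 <= ball_kernel C eta T k (r i).
Proof. exact: ball_kernel_ge0. Qed.

Let term_ge0 (b : I -> R) x ik : (forall i, 0 <= b i) ->
  0 <= b ik.1 * ball_kernel C eta T ik.2 (r ik.1) * in_ball x ik.
Proof. by move=> b0; exact: mulr_ge0 (mulr_ge0 (b0 _) (k0 _ _)) (in_ball_ge0 _ _). Qed.

Let pow_term_ge0 x ik :
  0 <= a ik.1 `^ p * ball_kernel C eta T ik.2 (r ik.1) `^ q * in_ball x ik.
Proof.
exact: mulr_ge0 (mulr_ge0 (powR_ge0 _ _) (powR_ge0 _ _)) (in_ball_ge0 _ _).
Qed.

Lemma potential_le1 (x : V) (X : R) : p <= 1 -> 0 < X ->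
  (potential_pow x <= X%:E)%E -> (potential a x <= (X `^ p^-1)%:E)%E.
Proof.
move=> p1 X0 HX; apply: esum_root => //.
  by move=> ik; exact: term_ge0.
apply: le_trans HX; apply: le_esum => ik _; rewrite lee_fin /q (min_idPr p1).
rewrite powRM ?in_ball_ge0//; last exact: mulr_ge0 (a0 _) (k0 _ _).
rewrite powRM ?a0 ?k0//.
by have [->|->] := in_ball01 x ik; rewrite ?powR1// powR0 ?gt_eqF.
Qed.

(* For [p >= 1], [a <= A] or [a <= A^(1 - p) a^p] linearises the power;
   the constant [A] is put on the ball [i0] that contains the whole domain. *)
Definition tilt (A : R) (i : I) : R :=
  A `^ (1 - p) * a i `^ p + A * (i == i0)%:R.

(** The first summand of [tilt] contributes at most [A]^ (1 - p) * A [^ p = A]. The second lives on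
    [i0] alone, where the kernels form a geometric series in [eta]. *)
Lemma potential_tilt (A : R) (x : V) : 1 <= p -> 0 < A ->
  (potential_pow x <= (A `^ p)%:E)%E ->
  (potential (tilt A) x <= (A * (1 + C / (1 - eta)))%:E)%E.
Proof.
move=> p1 A0 HX; have A0' := ltW A0.
have q1 : q = 1 by rewrite /q; apply/min_idPl.
have f1 ik : 0 <= A `^ (1 - p) * (a ik.1 `^ p * ball_kernel C eta T ik.2 (r ik.1) `^ q * in_ball x ik).
  exact: mulr_ge0 (powR_ge0 _ _) (pow_term_ge0 _ _).
have f2 ik : 0 <= A * C * ((ik.1 == i0)%:R * eta ^+ ik.2).
  by rewrite !mulr_ge0 ?exprn_ge0// ltW.
apply: (@le_trans _ _ (\esum_(ik in [set: I * nat])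
    ((A `^ (1 - p) * (a ik.1 `^ p * ball_kernel C eta T ik.2 (r ik.1) `^ q * in_ball x ik))%:E +
     (A * C * ((ik.1 == i0)%:R * eta ^+ ik.2))%:E))%E).
  apply: le_esum => ik _; rewrite -EFinD lee_fin q1 powRr1// /tilt !mulrDl.
  apply: lerD; first by rewrite -!mulrA.
  suff KN : ball_kernel C eta T ik.2 (r ik.1) * in_ball x ik <= C * eta ^+ ik.2.
    have e0 : 0 <= A * (ik.1 == i0)%:R by rewrite mulr_ge0.
    rewrite -mulrA; apply: le_trans (ler_wpM2l e0 KN) _.
    by rewrite le_eqVlt; apply/orP; left; apply/eqP; ring.
  apply: (@le_trans _ _ (ball_kernel C eta T ik.2 (r ik.1))).
    by have [->|->] := in_ball01 x ik; rewrite ?mulr1// mulr0 k0.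
  rewrite /ball_kernel ler_piMr ?mulr_ge0 ?exprn_ge0 ?(ltW C0) ?(ltW eta0)//.
  apply: exprn_ile1; last by rewrite ge_min lexx.
  by rewrite le_min ler01 !divr_ge0 ?exprn_ge0// ltW.
rewrite esumD; [|by move=> ik _; rewrite lee_fin..].
rewrite mulrDr mulr1 EFinD; apply: leeD.
  under eq_esum do rewrite EFinM.
  apply: le_trans (esumZl_le _ _ _ _ _ _) _; first exact: powR_ge0.
    by move=> ik; rewrite lee_fin; exact: pow_term_ge0.
  apply: le_trans (lee_wpmul2l _ HX) _; first by rewrite lee_fin powR_ge0.
  by rewrite -EFinM lee_fin -powRD_gt0// subrK powRr1.
under eq_esum do rewrite EFinM.
apply: le_trans (esumZl_le _ _ _ _ _ _) _; first by rewrite mulr_ge0// ltW.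
  by move=> ik; rewrite lee_fin mulr_ge0 ?exprn_ge0// ltW.
have -> : A * (C / (1 - eta)) = (A * C) * (1 - eta)^-1 by rewrite mulrA.
rewrite [leRHS]EFinM; apply: lee_wpmul2l; first by rewrite lee_fin mulr_ge0// ltW.
rewrite esum_prod/=; last by move=> ik; rewrite lee_fin mulr_ge0 ?exprn_ge0// ltW.
rewrite (esumID [set i0])//; last first.
  by move=> i _; apply: esum_ge0 => k _; rewrite lee_fin mulr_ge0 ?exprn_ge0// ltW.
rewrite setTI esum_set1; last first.
  by apply: esum_ge0 => k _; rewrite lee_fin mulr_ge0 ?exprn_ge0// ltW.
rewrite [X in (_ + X)%E]esum1 ?adde0; last first.
  move=> i [_ /= /eqP ii0]; apply: esum1 => k _.
  by rewrite (negbTE ii0) mul0r.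
rewrite eqxx; under eq_esum do rewrite mul1r.
by apply: esum_geometric => //; exact: ltW.
Qed.

Lemma oscillation_pow (x y : V) (X Y : R) : Om x -> Om y -> 0 < X -> 0 < Y ->
  (potential_pow x <= X%:E)%E -> (potential_pow y <= Y%:E)%E ->
  `|u x - u y| <= 2 * (1 + C / (1 - eta)) * (X `^ p^-1 + Y `^ p^-1).
Proof.
move=> Ox Oy X0 Y0 HX HY.
have K1 : 1 <= 1 + C / (1 - eta).
  by rewrite lerDl divr_ge0 ?(ltW C0)// subr_ge0 ltW.
have Xp := powR_gt0 p^-1 X0; have Yp := powR_gt0 p^-1 Y0.
have pinv (Z : R) : 0 < Z -> (Z `^ p^-1) `^ p = Z.
  by move=> Z0; rewrite -powRrM mulVf ?gt_eqF// powRr1// ltW.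
have [p1|/ltW p1] := leP p 1.
  have := osc a a0 cov x y _ _ Ox Oy (potential_le1 x X p1 X0 HX)
    (potential_le1 y Y p1 Y0 HY).
  move=> /le_trans; apply; rewrite ler_peMl ?addr_ge0 ?ltW//.
  by move: K1; lra.
(* [osc] needs the same heights at both points, so one [A] must dominate both roots. *)
set A := X `^ p^-1 + Y `^ p^-1.
have A0 : 0 < A by rewrite addr_gt0.
have XA : X <= A `^ p.
  by rewrite -{1}(pinv X X0); apply: powR_le_base; rewrite ?ltW// /A; lra.
have YA : Y <= A `^ p.
  by rewrite -{1}(pinv Y Y0); apply: powR_le_base; rewrite ?ltW// /A; lra.
have HXA : (potential_pow x <= (A `^ p)%:E)%E by apply: le_trans HX _; rewrite lee_fin.
have HYA : (potential_pow y <= (A `^ p)%:E)%E by apply: le_trans HY _; rewrite lee_fin.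
have tilt0 i : 0 <= tilt A i.
  by rewrite /tilt addr_ge0 ?mulr_ge0 ?powR_ge0// ltW.
have covA z : Om z -> exists i, `|z - c i| < r i /\ grad_norm u z < tilt A i.
  move=> Oz; have [i [zi gi]] := cov z Oz.
  have [aA|Aa] := leP (a i) A.
    exists i0; split; first exact: big_ball.
    apply: lt_le_trans gi _; apply: le_trans aA _.
    by rewrite /tilt eqxx mulr1 lerDr mulr_ge0 ?powR_ge0.
  exists i; split => //; apply: lt_le_trans gi _.
  have ai : 0 < a i by exact: lt_trans Aa.
  apply: (@le_trans _ _ (A `^ (1 - p) * a i `^ p)); last first.
    by rewrite /tilt lerDl mulr_ge0// ltW.
  have e1 : a i = a i `^ p * a i `^ (1 - p).
    by rewrite -powRD_gt0// addrC subrK powRr1// ltW.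
  rewrite {1}e1 mulrC; apply: ler_wpM2r; first exact: powR_ge0.
  rewrite -[1 - p]opprB !powRN lef_pV2 ?posrE ?powR_gt0//.
  by apply: powR_le_base; rewrite ?subr_ge0// ltW.
apply: le_trans (osc (tilt A) tilt0 covA x y _ _ Ox Oy
  (potential_tilt A x p1 A0 HXA) (potential_tilt A y p1 A0 HYA)) _.
by rewrite le_eqVlt; apply/orP; left; apply/eqP; ring.
Qed.

End oscillation.

(* In dimension one, pairwise intersecting intervals have a common point. *)
Lemma best_constant (R : realType) (V : Type) (Om : set V) (u : V -> R)
    (Sg : V -> \bar R) (p K : R) : 0 < p -> 0 < K ->
  (forall x, Om x -> (0 < Sg x)%E) ->
  (forall x y X Y, Om x -> Om y -> 0 < X -> 0 < Y ->
    (Sg x <= X%:E)%E -> (Sg y <= Y%:E)%E ->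
    `|u x - u y| <= K * (X `^ p^-1 + Y `^ p^-1)) ->
  exists b, forall x, Om x -> ((`|u x - b| `^ p)%:E <= (K `^ p)%:E * Sg x)%E.
Proof.
move=> p0 K0 Sg0 H; pose val x := K * (fine (Sg x)) `^ p^-1.
(* Left end points of the intervals of radius [val x] about [u x]. Points with infinite [Sg] are
   left out, since [fine] would send them to 0; there the claim is trivial. *)
pose E := [set t | exists2 x, Om x /\ (Sg x < +oo)%E & t = u x - val x].
exists (sup E) => x Ox; have Sx := Sg0 x Ox.
have Kp : 0 < K `^ p by rewrite powR_gt0.
have [Sfin|] := boolP (Sg x < +oo)%E; last first.
  by rewrite -leNgt leye_eq => /eqP->; rewrite gt0_muley ?leey// lte_fin.
have fSx y : Om y -> (Sg y < +oo)%E -> 0 < fine (Sg y) /\ Sg y = (fine (Sg y))%:E.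
  move=> Oy Sy; have Sy0 := Sg0 y Oy; split; first by rewrite fine_gt0// Sy0.
  by rewrite fineK// ge0_fin_numE// ltW.
have pair y z : Om y -> Om z -> (Sg y < +oo)%E -> (Sg z < +oo)%E ->
    u y - val y <= u z + val z.
  move=> Oy Oz Sy Sz; have [fy ey] := fSx y Oy Sy; have [fz ez] := fSx z Oz Sz.
  have := H y z _ _ Oy Oz fy fz; rewrite -ey -ez => /(_ (lexx _) (lexx _)).
  by rewrite ler_norml mulrDr -/(val y) -/(val z) => /andP[_]; lra.
have Ene : E !=set0 by exists (u x - val x); exists x.
have up : ubound E (u x + val x) by move=> _ [y [Oy Sy] ->]; exact: pair.
have b1 : sup E <= u x + val x by exact: ge_sup.
have b2 : u x - val x <= sup E.
  by apply: ub_le_sup; [exists (u x + val x)|exists x].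
have ub : `|u x - sup E| <= val x by rewrite ler_norml; apply/andP; split; lra.
have [fx ex] := fSx x Ox Sfin; rewrite ex -EFinM lee_fin.
apply: le_trans (powR_le_base _ _ _ _ (ltW p0) (normr_ge0 _) ub) _.
rewrite /val powRM ?powR_ge0 ?(ltW K0)// -powRrM mulVf ?gt_eqF//.
by rewrite powRr1// ltW.
Qed.

(** * Proof of the Poincare inequality on a John domain *)

Section core.
Variables (R : realType) (n : nat) (s delta p : R) (Om : set 'rV[R]_n).
Hypotheses (n2 : (2 <= n)%N) (s1 : 1 <= s) (sn : s < n%:R / (n%:R - 1)).
Hypotheses (delta0 : 0 < delta) (deltan : delta <= n%:R) (deltap : delta / n%:R < p).
Variables (T c D : R) (x0 : 'rV[R]_n).
Hypotheses (T0 : 0 < T) (c0 : 0 < c) (D0 : 0 < D) (OmD : forall x, Om x -> `|x| < D).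
Hypothesis curves : forall x, Om x -> exists gam : R -> 'rV[R]_n,
  [/\ gam 0 = x, gam T = x0,
    forall a b, 0 <= a <= T -> 0 <= b <= T -> `|gam a - gam b| <= `|a - b| &
    forall t y, 0 <= t <= T -> `|y - gam t| < c * t `^ s -> Om y].

Let C : R := 2 * n%:R * 119 ^+ n * weight_const R n s T c.
Let eta : R := decay R n s.
Let q : R := Num.min 1 p.
Let K : R := 2 * (1 + C / (1 - eta)).

Let n0 : 0 < n%:R :> R. Proof. by rewrite ltr0n; apply: leq_trans n2. Qed.
Let p0 : 0 < p. Proof. by apply: lt_trans deltap; rewrite divr_gt0. Qed.
Let C0 : 0 < C.
Proof.
apply: mulr_gt0; last exact: weight_const_gt0.
by rewrite !mulr_gt0 ?exprn_gt0.
Qed.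
Let eta0 : 0 < eta. Proof. exact: decay_gt0. Qed.
Let eta1 : eta < 1. Proof. exact: decay_lt1. Qed.
Let q0 : 0 < q. Proof. by rewrite lt_min ltr01. Qed.
Let K0 : 0 < K.
Proof. by rewrite mulr_gt0// addr_gt0// divr_gt0// subr_gt0. Qed.
Let deltaq : delta <= n%:R * q.
Proof.
rewrite /q; have [_|_] := leP 1 p; first by rewrite mulr1.
by rewrite mulrC -ler_pdivrMr// ltW.
Qed.
Let etaq1 : eta `^ q < 1.
Proof.
have : eta `^ q < 1 `^ q by apply: gt0_ltr_powR; rewrite ?nnegrE// ltW.
by rewrite powR1.
Qed.

(** Both values are compared with the same [base_avg], at a mesh [M] beyond the thresholds of both
    points. *)
Lemma linear_oscillation (u : 'rV[R]_n -> R) (I : choiceType) (b r : I -> R)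
    (ce : I -> 'rV[R]_n) :
  C1_on Om u -> (forall i, 0 <= b i) -> (forall i, 0 <= r i) ->
  (forall y, Om y -> exists i, `|y - ce i| < r i /\ grad_norm u y < b i) ->
  forall x y X Y, Om x -> Om y ->
  (potential R n I r ce T C eta b x <= X%:E)%E ->
  (potential R n I r ce T C eta b y <= Y%:E)%E -> `|u x - u y| <= X + Y.
Proof.
move=> uC1 b0 r0 cov x y X Y Ox Oy HX HY.
have n0' : (0 < n)%N by apply: leq_trans n2.
pose h := john_radius R s T c.
have swE z ik : stage_weight R n I b r ce (h ik.2) (T / 2 ^+ ik.2) z ik.1 =
    b ik.1 * ball_kernel R n C eta T ik.2 (r ik.1) * in_ball R n I r ce T z ik.
  rewrite /stage_weight /in_ball.
  have := john_radius_weight R n s T c n2 s1 T0 c0 ik.2 (r ik.1) (r0 _).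
  rewrite -/(h _) -/eta => hw.
  rewrite /ball_kernel /C; set N := (nat_of_bool _)%:R.
  transitivity (2 * n%:R * 119 ^+ n * b ik.1 *
    (h ik.2 * (Num.min (r ik.1) (T / 2 ^+ ik.2) / h ik.2) ^+ n) * N); first by ring.
  by rewrite hw; ring.
have crv z : Om z -> exists gam : R -> 'rV[R]_n,
    [/\ gam 0 = z, gam T = x0,
    forall t t', 0 <= t <= T -> 0 <= t' <= T -> `|gam t - gam t'| <= `|t - t'| &
    forall k t w, T / 2 ^+ k.+1 <= t <= T / 2 ^+ k ->
      `|w - gam t| <= 3 * h k -> Om w].
  move=> /curves[gam [g0 gT lip KO]]; exists gam; split => // k t w /andP[t1 t2] wt.
  have t0 : 0 < t by apply: lt_le_trans t1; rewrite divr_gt0// exprn_gt0.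
  apply: (KO t w); last by apply: le_lt_trans wt _; exact: (john_radius_lt_john R n).
  rewrite (ltW t0)/=; apply: le_trans t2 _.
  by rewrite ler_pdivrMr ?exprn_gt0// ler_peMr ?(ltW T0)// exprn_ege1// ler1n.
have cb z Z e : Om z -> (potential R n I r ce T C eta b z <= Z%:E)%E -> 0 < e ->
    exists M0, forall M, (M0 <= M)%N -> `|u z - base_avg R n u x0 h M| <= Z + e.
  move=> Oz HZ e0.
  apply: (chain_bound R n u Om I b r ce b0 r0 uC1 cov T x0 h) => //.
  - by move=> k; exact: (john_radius_gt0 R s).
  - by move=> k; exact: (john_radius_le_tau R s).
  - by move=> k; exact: (john_radius_ge R n).
  - by move=> k; exact: (john_radius_le R s).
  by apply: le_trans HZ; apply: le_esum => ik _; rewrite lee_fin swE.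
apply/ler_addgt0Pr => e e0; have e2 : 0 < e / 2 by rewrite divr_gt0.
have [M1 HM1] := cb x X _ Ox HX e2; have [M2 HM2] := cb y Y _ Oy HY e2.
have h1 := HM1 (maxn M1 M2) (leq_maxl _ _); have h2 := HM2 (maxn M1 M2) (leq_maxr _ _).
apply: le_trans (ler_distD (base_avg R n u x0 h (maxn M1 M2)) _ _) _.
by rewrite [X in _ + X]distrC; lra.
Qed.

Let Q : R := (n.+1%:R `^ delta * (3 ^+ n * 2 `^ delta)) *
  (K `^ p * (C `^ q * 5 `^ delta * (1 - eta `^ q)^-1)).

Let Q0 : 0 < Q.
Proof.
rewrite /Q !mulr_gt0 ?exprn_gt0 ?powR_gt0 ?ltr0n//.
by rewrite invr_gt0 subr_gt0.
Qed.

Lemma choquet_osc (u : 'rV[R]_n -> R) (I : countType) (a r : I -> R)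
    (ce : I -> 'rV[R]_n) (i0 : I) :
  C1_on Om u -> (forall i, 0 <= a i) -> (forall i, 0 <= r i) -> 0 < a i0 ->
  (forall y, Om y -> exists i, `|y - ce i| < r i /\ grad_norm u y < a i) ->
  (forall y, Om y -> `|y - ce i0| < r i0) ->
  exists b, (choquet delta Om (fun x => (`|u x - b| `^ p)%R) <=
    Q%:E * \esum_(i in [set: I]) (a i `^ p * r i `^ delta)%:E)%E.
Proof.
move=> uC1 a0 r0 ai0 cov big.
have kn0 k i : 0 <= ball_kernel R n C eta T k (r i) by exact: ball_kernel_ge0.
have near0 x ik : 0 <= in_ball R n I r ce T x ik by exact: ler0n.
have tm0 ik : 0 <= a ik.1 `^ p * ball_kernel R n C eta T ik.2 (r ik.1) `^ q.
  exact: mulr_ge0 (powR_ge0 _ _) (powR_ge0 _ _).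
(* [best_constant] needs positivity, supplied by the term of [i0] at scale 0. *)
have Sg0 x : Om x -> (0 < potential_pow R n p I a r ce T C eta x)%E.
  move=> Ox; apply: (@lt_le_trans _ _
    (a i0 `^ p * ball_kernel R n C eta T 0 (r i0) `^ q * in_ball R n I r ce T x (i0, 0%N))%:E).
    have ri : 0 < r i0 by exact: le_lt_trans (big x Ox).
    have -> : in_ball R n I r ce T x (i0, 0%N) = 1.
      rewrite /in_ball/= (lt_le_trans (big x Ox))//.
      by rewrite lerDl mulr_ge0// divr_ge0 ?exprn_ge0// ltW.
    have kp : 0 < ball_kernel R n C eta T 0 (r i0).
      rewrite /ball_kernel; apply: mulr_gt0.
        by rewrite mulr_gt0// exprn_gt0.
      by rewrite exprn_gt0// lt_min ltr01 divr_gt0// divr_gt0// exprn_gt0.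
    by rewrite lte_fin mulr1; exact: mulr_gt0 (powR_gt0 _ ai0) (powR_gt0 _ kp).
  apply: le_trans (seq_le_esum _ _ _ [:: (i0, 0%N)] _ _) => //; first by rewrite big_seq1.
  by move=> ik; rewrite lee_fin; exact: mulr_ge0 (tm0 ik) (near0 x ik).
have [b Hb] := best_constant R _ Om u _ p K p0 K0 Sg0
  (fun x y X Y => oscillation_pow R n p p0 u Om I a r ce i0 a0 r0 T C eta T0 C0 eta0
     eta1 cov big (fun b b0 hb => linear_oscillation u I b r ce uC1 b0 r0 hb) x y X Y).
exists b.
pose lam (ik : I * nat) := K `^ p * (a ik.1 `^ p * ball_kernel R n C eta T ik.2 (r ik.1) `^ q).
pose rho (ik : I * nat) := r ik.1 + 4 * (T / 2 ^+ ik.2).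
have tk0 k : 0 < T / 2 ^+ k by rewrite divr_gt0// exprn_gt0.
have lam0 ik : 0 <= lam ik by exact: mulr_ge0 (powR_ge0 _ _) (tm0 ik).
have rho0 ik : 0 <= rho ik by rewrite addr_ge0// mulr_ge0// ltW.
apply: le_trans (choquet_balls R n delta D delta0 D0 (I * nat)%type
  (fun ik => ce ik.1) rho lam Om _ OmD lam0 rho0 _) _.
  move=> x Ox; apply: le_trans (Hb x Ox) _.
  apply: le_trans (esumZl_ge _ _ _ _ _ _) _; first by rewrite powR_gt0.
    by move=> ik; rewrite lee_fin; exact: mulr_ge0 (tm0 ik) (near0 x ik).
  apply: le_esum => ik _; rewrite -EFinM lee_fin mulrA.
  exact: lexx.
rewrite /Q [X in (_ <= X * _)%E]EFinM -[leRHS]muleA; apply: lee_wpmul2l.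
  by rewrite lee_fin !mulr_ge0 ?exprn_ge0 ?powR_ge0.
pose E : R := C `^ q * 5 `^ delta.
have E0 : 0 <= E by rewrite mulr_ge0 ?powR_ge0.
have et0 : 0 <= eta `^ q by exact: powR_ge0.
rewrite esum_prod/=; last first.
  by move=> ik; rewrite lee_fin; exact: mulr_ge0 (lam0 ik) (powR_ge0 _ _).
apply: (@le_trans _ _ (\esum_(i in [set: I])
   ((K `^ p * (E * (1 - eta `^ q)^-1))%:E * (a i `^ p * r i `^ delta)%:E))%E); last first.
  apply: esumZl_le.
    by rewrite mulr_ge0 ?powR_ge0// mulr_ge0// invr_ge0 subr_ge0 ltW.
  by move=> i; rewrite lee_fin mulr_ge0 ?powR_ge0.
apply: le_esum => i _.
have P0 : 0 <= K `^ p * (a i `^ p * (E * r i `^ delta)).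
  by rewrite !mulr_ge0 ?powR_ge0.
apply: (@le_trans _ _ (\esum_(k in [set: nat])
   ((K `^ p * (a i `^ p * (E * r i `^ delta)))%:E * ((eta `^ q) ^+ k)%:E))%E).
  apply: le_esum => k _; rewrite -EFinM lee_fin /lam /rho /=.
  have KB := ball_kernel_power_bound R n C eta T q delta k (r i) C0 eta0 T0 (r0 i) q0 delta0 deltaq.
  have A0 : 0 <= K `^ p * a i `^ p by rewrite mulr_ge0 ?powR_ge0.
  have := ler_wpM2l A0 KB; set KK := _ `^ q; set RR := (_ + _) `^ delta.
  rewrite -/E => h.
  have -> : K `^ p * (a i `^ p * KK) * RR = K `^ p * a i `^ p * (KK * RR) by ring.
  apply: le_trans h _.
  by rewrite le_eqVlt; apply/orP; left; apply/eqP; ring.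
apply: le_trans (esumZl_le _ _ _ _ P0 _) _.
  by move=> k; rewrite lee_fin exprn_ge0.
apply: le_trans (lee_wpmul2l _ (esum_geometric _ _ et0 etaq1)) _; first by rewrite lee_fin.
rewrite -!EFinM lee_fin.
by rewrite le_eqVlt; apply/orP; left; apply/eqP; ring.
Qed.

Lemma poincare_fin (u : 'rV[R]_n -> R) (J : R) : C1_on Om u ->
  (choquet delta Om (fun x => (grad_norm u x `^ p)%R) <= J%:E)%E ->
  (ereal_inf [set choquet delta Om (fun x => (`|u x - b| `^ p)%R) | b in [set: R]]
    <= (Q * 3 `^ p * (1 - 2^-1 `^ p)^-1 * J)%:E)%E.
Proof.
move=> uC1 HJ; apply/lee_addgt0Pr => e e0.
pose W := Q * (2 `^ p * D `^ delta + 3 `^ p).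
have W0 : 0 < W by rewrite mulr_gt0// addr_gt0 ?mulr_gt0 ?powR_gt0.
pose e1 := e / W; have e10 : 0 < e1 by rewrite divr_gt0.
pose t := Num.min e1 (e1 `^ p^-1).
have t0 : 0 < t by rewrite lt_min e10 powR_gt0.
have tp : t `^ p <= e1.
  have -> : e1 = (e1 `^ p^-1) `^ p by rewrite -powRrM mulVf ?gt_eqF// powRr1// ltW.
  by apply: powR_le_base; rewrite ?(ltW p0) ?(ltW t0)// ge_min lexx orbT.
have te : t <= e1 by rewrite ge_min lexx.
(* The number [t] serves both as the lowest level and as the excess of the cover. *)
have [ce [r [r0 cov tot]]] := choquet_cover R n delta p t p0 t0 Om
  (grad_norm u) (grad_norm_ge0 R n u) J HJ.
pose I : countType := option (nat * nat).
(* The index [None] is a ball containing the whole domain, for points with gradient at most [t]. The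
   factors 3 and 2 make the gradient bounds strict. *)
pose a' (i : I) : R := if i is Some mj then 3 * (t * 2 ^+ mj.1) else 2 * t.
pose r' (i : I) : R := if i is Some mj then r mj else D.
pose c' (i : I) : 'rV[R]_n := if i is Some mj then ce mj else 0.
have tm k : 0 < t * 2 ^+ k by rewrite mulr_gt0// exprn_gt0.
have a'0 i : 0 < a' i by case: i => [mj|] /=; rewrite mulr_gt0.
have r'0 i : 0 <= r' i by case: i => [mj|] //=; exact: ltW.
have big y : Om y -> `|y - c' None| < r' None by move=> Oy; rewrite subr0; exact: OmD.
have cov' y : Om y -> exists i, `|y - c' i| < r' i /\ grad_norm u y < a' i.
  move=> Oy; have [gt|tg] := leP (grad_norm u y) t.
    exists None; split; first exact: big.
    by apply: le_lt_trans gt _ => /=; lra.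
  have [mj [g1 g2]] := cov y Oy tg; exists (Some mj); split => /=.
    by apply: le_lt_trans g2; exact: norm_le_enorm.
  by apply: le_lt_trans g1 _; have := tm mj.1; lra.
have [b Hb] := choquet_osc u I a' r' c' None uC1 (fun i => ltW (a'0 i)) r'0
  (a'0 None) cov' big.
apply: ge_ereal_inf; exists (choquet delta Om (fun x => (`|u x - b| `^ p)%R)).
  by exists b.
apply: le_trans Hb _.
have beta0 := half_powR_lt1 R p p0; set beta := 1 - _ in beta0 tot *.
have S : (\esum_(i in [set: I]) (a' i `^ p * r' i `^ delta)%:E <=
    ((2 * t) `^ p * D `^ delta + 3 `^ p * (beta^-1 * J + t))%:E)%E.
  rewrite esum_option/=; last by move=> i; rewrite lee_fin mulr_ge0 ?powR_ge0.
  rewrite EFinD; apply: leeD => //.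
  apply: (@le_trans _ _ (\esum_(mj in [set: nat * nat])
     ((3 `^ p)%:E * ((t * 2 ^+ mj.1) `^ p * r mj `^ delta)%:E))%E).
    apply: le_esum => mj _; rewrite -EFinM lee_fin powRM ?(ltW (tm _))//.
    by rewrite mulrA.
  apply: le_trans (esumZl_le _ _ _ _ (powR_ge0 _ _) _) _.
    by move=> mj; rewrite lee_fin mulr_ge0 ?powR_ge0.
  rewrite EFinM; apply: lee_wpmul2l tot; first by rewrite lee_fin powR_ge0.
apply: le_trans (lee_wpmul2l _ S) _; first by rewrite lee_fin ltW.
rewrite -EFinM -EFinD lee_fin powRM ?(ltW t0)//.
have h1 : 2 `^ p * t `^ p * D `^ delta <= 2 `^ p * D `^ delta * e1.
  by rewrite mulrAC ler_wpM2l// mulr_ge0 ?powR_ge0.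
have h2 : 3 `^ p * t <= 3 `^ p * e1 by rewrite ler_wpM2l ?powR_ge0.
have We : W * e1 = e by rewrite /e1 mulrC divfK// gt_eqF.
rewrite -[X in _ <= _ + X]We.
have -> : Q * 3 `^ p * beta^-1 * J + W * e1 =
  Q * ((2 `^ p * D `^ delta * e1) + 3 `^ p * (beta^-1 * J) + 3 `^ p * e1).
  by rewrite /W; ring.
rewrite ler_wpM2l ?(ltW Q0)// mulrDr addrA.
by apply: lerD => //; apply: lerD.
Qed.

Lemma poincare_core : exists k : R, 0 < k /\
    forall u : 'rV[R]_n -> R, C1_on Om u ->
      (ereal_inf [set choquet delta Om (fun x => (`|u x - b| `^ p)%R) | b in [set: R]]
        <= k%:E * choquet delta Om (fun x => (grad_norm u x `^ p)%R))%E.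
Proof.
have beta0 := half_powR_lt1 R p p0.
exists (Q * 3 `^ p * (1 - 2^-1 `^ p)^-1).
have k0 : 0 < Q * 3 `^ p * (1 - 2^-1 `^ p)^-1.
  apply: mulr_gt0; last by rewrite invr_gt0.
  by apply: mulr_gt0 Q0 _; exact: powR_gt0.
split => // u uC1.
set J := choquet _ _ _; have J0 : (0 <= J)%E.
  by apply: integral_ge0 => t _; exact: Hcontent_ge0.
(* If the right-hand integral is infinite, so is its product with the positive constant. *)
have [Jfin|] := boolP (J < +oo)%E; last first.
  by rewrite -leNgt leye_eq => /eqP->; rewrite gt0_muley ?leey// lte_fin.
have JE : J = (fine J)%:E by rewrite fineK// ge0_fin_numE.
by rewrite JE -EFinM; apply: poincare_fin => //; rewrite -JE.
Qed.

End core.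

Theorem theorem4p4 (R : realType) (n : nat) (s delta p : R) (Omega : set 'rV[R]_n) :
  (2 <= n)%N ->
  ebounded Omega ->
  sJohn_domain s Omega ->
  1 <= s -> s < n%:R / (n%:R - 1) ->
  0 < delta -> delta <= n%:R ->
  delta / n%:R < p ->
  exists c : R, 0 < c /\
    forall u : 'rV[R]_n -> R, C1_on Omega u ->
      (ereal_inf [set choquet delta Omega (fun x => (`|u x - b| `^ p)%R) | b in [set: R]]
        <= c%:E * choquet delta Omega (fun x => (grad_norm u x `^ p)%R))%E.
Proof.
move=> n2 [M OM] J s1 sn d0 dn dp.
have n0 : (0 < n)%N by apply: leq_trans n2.
have [T [c [x0 [T0 c0 crv]]]] := john_curves R n s Omega n0 s1 J.
have OD x : Omega x -> `|x| < Num.max M 0 + 1.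
  move=> /OM xM; apply: le_lt_trans (norm_le_enorm R n x) _.
  by apply: le_lt_trans xM _; rewrite ltr_pwDr// le_max lexx.
have D0 : 0 < Num.max M 0 + 1 by rewrite ltr_pwDr// le_max lexx orbT.
exact: (poincare_core R n s delta p Omega n2 s1 sn d0 dn dp T c _ x0 T0 c0 D0 OD crv).
Qed.
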